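(* For every singular cardinal $\mu$ with $\operatorname{cf}\mu=\aleph_0$, the Baire number of $U(\mu)$, the space of uniform ultrafilters over $\mu$, is equal to $\omega_2$.
   Context: An ultrafilter $F$ over $\mu$ is uniform if it contains no set of cardinality $<\mu$. $U(\mu)$ is the set of all uniform ultrafilters over $\mu$, with the topology whose basic open sets are $\hat p=\{F\in U(\mu): p\in F\}$ for $p\subseteq\mu$ with $|p|=\mu$. The Baire number of a topological space with no isolated points is the least cardinality of a family of nowhere dense sets which covers the space. *)

(* Defs.v *)
From HB Require Import structures.
From mathcomp Require Import all_boot all_order.
From mathcomp Require Import mathcomp_extra boolp classical_sets functions.
From mathcomp Require Import cardinality filter topology.
From mathcomp Require wochoice.

Set Implicit Arguments.
Unset Strict Implicit.
Unset Printing Implicit Defensive.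

Import Order.TTheory.

Local Open Scope classical_set_scope.
Local Open Scope card_scope.
Local Open Scope order_scope.

(* Cardinals: a cardinal number is given by any set of that cardinality and
   compared with [#<=] and [#=].  When its order matters (for cofinality), a
   cardinal is an initial ordinal, i.e. a well-ordered type that has strictly
   more elements than each of its proper initial segments. *)

Definition card_lt (T U : Type) (A : set T) (B : set U) : Prop :=
  A #<= B /\ ~ (B #<= A).

Definition is_initial_ordinal (d : Order.disp_t) (mu : orderType d) : Prop :=
  wochoice.well_order (<=%O : rel mu) /\
  forall x : mu, card_lt [set y | y < x] [set: mu].

Definition is_succ_card (T U : Type) (A : set T) (B : set U) : Prop :=
  card_lt A B /\
  forall (V : Type) (C : set V), card_lt A C -> B #<= C.

Fixpoint is_aleph (n : nat) (T : Type) (A : set T) : Prop :=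
  match n with
  | 0 => A #= [set: nat]
  | m.+1 => exists (V : Type) (B : set V), is_aleph m B /\ is_succ_card B A
  end.

Definition cofinal (d : Order.disp_t) (mu : orderType d) (A : set mu) : Prop :=
  forall x : mu, exists2 y, A y & x <= y.

Definition is_cofinality (d : Order.disp_t) (mu : orderType d)
    (T : Type) (K : set T) : Prop :=
  (exists2 A : set mu, cofinal A & A #= K) /\
  (forall A : set mu, cofinal A -> K #<= A).

Definition is_singular_cardinal (d : Order.disp_t) (mu : orderType d) : Prop :=
  [/\ is_initial_ordinal mu, infinite_set [set: mu] &
      exists2 K : set mu, is_cofinality mu K & card_lt K [set: mu]].

Definition is_uniform (mu : Type) (F : set_system mu) : Prop :=
  forall p : set mu, card_lt p [set: mu] -> ~ F p.

Record uniform_ultrafilters (mu : Type) := UniformUltrafilter {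
  ultrafilter_sets :> set_system mu;
  ultrafilter_ultra : UltraFilter ultrafilter_sets;
  ultrafilter_uniform : is_uniform ultrafilter_sets
}.

Definition basic_open (mu : Type) (p : set mu) : set (uniform_ultrafilters mu) :=
  [set F : uniform_ultrafilters mu | ultrafilter_sets F p].

Section UniformUltrafilterTopology.
Variable mu : Type.

Let large : set (set mu) := [set p | p #= [set: mu]].

Lemma uniform_ultrafilter_large (F : uniform_ultrafilters mu) (p : set mu) :
  ultrafilter_sets F p -> p #= [set: mu].
Proof.
move=> Fp; rewrite card_eq_le card_leT /=; apply: contrapT => np.
by apply: (ultrafilter_uniform (p := p) _ Fp); split; first exact: card_leT.
Qed.

Let basic_open_cover : \bigcup_(p in large) @basic_open mu p = setT.
Proof.
rewrite -subTset => F _; exists setT; first exact: card_eqxx.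
by have FU := ultrafilter_ultra F; exact: filterT.
Qed.

Let basic_open_join (p q : set mu) (F : uniform_ultrafilters mu) :
  large p -> large q -> basic_open p F -> basic_open q F ->
  exists r, [/\ large r, basic_open r F &
                basic_open r `<=` basic_open p `&` basic_open q].
Proof.
move=> _ _ Fp Fq; have FU := ultrafilter_ultra F.
have Fpq : ultrafilter_sets F (p `&` q) by exact: filterI.
exists (p `&` q); split=> //; first exact: uniform_ultrafilter_large Fpq.
move=> G; have GU := ultrafilter_ultra G; rewrite /basic_open /= => Gpq.
by split; apply: filterS Gpq => x [].
Qed.

HB.instance Definition _ := gen_eqMixin (uniform_ultrafilters mu).
HB.instance Definition _ := gen_choiceMixin (uniform_ultrafilters mu).
HB.instance Definition _ := isBaseTopological.Build (uniform_ultrafilters mu)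
  basic_open_cover basic_open_join.

End UniformUltrafilterTopology.

Definition nowhere_dense (X : topologicalType) (A : set X) : Prop :=
  interior (closure A) = set0.

Definition nowhere_dense_cover (X : topologicalType) (C : set (set X)) : Prop :=
  (forall A, C A -> nowhere_dense A) /\ \bigcup_(A in C) A = setT.

(* The Baire number is meant for spaces without isolated points; this is not a
   separate requirement because no nowhere dense set contains an isolated
   point, so that a space with one has no nowhere dense cover at all. *)
Definition is_baire_number (X : topologicalType) (T : Type) (K : set T) : Prop :=
  (exists2 C : set (set X), nowhere_dense_cover C & C #= K) /\
  (forall C : set (set X), nowhere_dense_cover C -> K #<= C).

(* Main.v *)
(* Call a set small if it has fewer than mu elements. Since cf mu = omega, a
   sequence of large sets that decreases modulo small sets has a large lower
   bound modulo small sets. Hence omega1 nowhere dense sets can be avoided one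
   after the other along a descending chain of length omega1, and the chain
   extends to a uniform ultrafilter.

   For a cover by omega2 nowhere dense sets, let a large set decide, level by
   level below omega1, the entries of a path, so that incompatible paths are
   decided by almost disjoint sets. Attach to each level a < omega1 a labelling
   of the paths of length a by ordinals i < omega2. An ultrafilter decides at
   most one path of each length, so it meets at most omega1 labels. It is enough
   that below every large set, every label can be decided at some level: then
   the ultrafilters that do not meet i form a nowhere dense set, and these sets
   cover the space. In each block of mu, an entry of a path refines the block to
   an interval below one of its elements, and these right endpoints strictly
   decrease along the path; so no large set follows one path through omega1
   levels.

   If mu <= 2^omega, every large set therefore splits again and again into
   different paths, and contains a Cantor tree of 2^omega paths of some
   countable length. This tree is coded by a set of natural numbers, so all
   trees of that length can be given every label by a Bernstein induction.

   If 2^omega < mu, club guessing in the blocks provides mu^omega systems, each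
   of mu^omega eventually disjoint choices of slots, such that every large set
   meets all the slots of some system. At each level, the entries are built
   greedily along a well-order of the triples (system, set of blocks, label).
   Either a system finds a slot for all labels at once, or the system
   stays alive on too many paths of some length, which a second induction can
   label; otherwise a counting argument yields a slot that follows one path
   through omega1 levels, which is impossible. *)

Require Import Defs.
From mathcomp Require Import all_boot all_order.
From mathcomp Require Import mathcomp_extra boolp classical_sets functions.
From mathcomp Require Import cardinality filter topology.
From mathcomp Require wochoice.

Set Implicit Arguments.
Unset Strict Implicit.
Unset Printing Implicit Defensive.

Import Order.TTheory.

Local Open Scope classical_set_scope.
Local Open Scope card_scope.

(** * Cardinals *)

(** A total injective relation can replace an injection: it needs neither a choice of values nor an
    inhabitant of [U] for points outside [A]. *)
Lemma card_leRP T U (A : set T) (B : set U) :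
  A #<= B <-> exists R : T -> U -> Prop,
    (forall x, A x -> exists2 y, B y & R x y) /\
    (forall x x' y, A x -> A x' -> R x y -> R x' y -> x = x').
Proof.
split=> [/card_leP[f]|[R [tR iR]]].
  exists (fun x y => exists (a : A), val a = x /\ val (f a) = y); split.
    move=> x Ax; exists (val (f (exist _ x (mem_set Ax)))).
      exact: set_valP.
    by exists (exist _ x (mem_set Ax)).
  move=> x x' y _ _ [a [<- <-]] [a' [<- /val_inj]] ff.
  by have -> : a' = a by apply: (@inj _ _ _ f) => //; rewrite inE.
pose h (a : A) : B :=
  let s := cid2 (tR (val a) (set_valP a)) in exist _ (s2val s) (mem_set (s2valP s)).
apply/card_leP/injfunPex; exists h => // a a' _ _ /(congr1 val) /= e.
apply: val_inj; apply: (iR _ _ (s2val (cid2 (tR (val a) (set_valP a))))).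
- exact: set_valP.
- exact: set_valP.
- exact: (s2valP' (cid2 (tR (val a) (set_valP a)))).
- rewrite e; exact: (s2valP' (cid2 (tR (val a') (set_valP a')))).
Qed.

Lemma card_le_fun T U (A : set T) (B : set U) (f : T -> U) :
  (forall x, A x -> B (f x)) ->
  (forall x x', A x -> A x' -> f x = f x' -> x = x') -> A #<= B.
Proof.
move=> fB fi; apply/card_leRP; exists (fun x y => f x = y); split.
  by move=> x Ax; exists (f x) => //; exact: fB.
by move=> x x' y Ax Ax' e e'; apply: fi => //; rewrite e e'.
Qed.

Lemma card_leX T U T' U' (A : set T) (B : set U) (A' : set T') (B' : set U') :
  A #<= A' -> B #<= B' -> A `*` B #<= A' `*` B'.
Proof.
move=> /card_leRP[R [tR iR]] /card_leRP[Q [tQ iQ]]; apply/card_leRP.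
exists (fun x y => R x.1 y.1 /\ Q x.2 y.2); split.
  move=> [x y] [/= /tR[x' A'x' xx'] /tQ[y' B'y' yy']].
  by exists (x', y').
move=> [x1 x2] [y1 y2] [z1 z2] [/= a b] [/= c d] [e f] [g h].
by rewrite (iR _ _ _ a c e g) (iQ _ _ _ b d f h).
Qed.

(** Zorn's lemma gives a maximal graph of a partial injection. It is total on [A] or reaches all of
    [B], since otherwise a pair could be added. *)
Lemma card_le_total T U (A : set T) (B : set U) : A #<= B \/ B #<= A.
Proof.
pose P : set (set (T * U)) := [set G | [/\ G `<=` A `*` B,
  forall x x' y, G (x, y) -> G (x', y) -> x = x' &
  forall x y y', G (x, y) -> G (x, y') -> y = y']].
have [F FP Ftot|G [[GAB Gl Gr] Gmax]] := @Zorn_bigcup _ P.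
  split.
  - by move=> p [X FX Xp]; have [+ _ _] := FP _ FX; apply.
  - move=> x x' y [X FX Xp] [Y FY Yp].
    case: (Ftot _ _ FX FY) => s.
      by have [_ h _] := FP _ FY; exact: h (s _ Xp) Yp.
    by have [_ h _] := FP _ FX; exact: h Xp (s _ Yp).
  - move=> x y y' [X FX Xp] [Y FY Yp].
    case: (Ftot _ _ FX FY) => s.
      by have [_ _ h] := FP _ FY; exact: h (s _ Xp) Yp.
    by have [_ _ h] := FP _ FX; exact: h Xp (s _ Yp).
have [tA|/existsNP[a /not_implyP[Aa Na]]] :=
    pselect (forall x, A x -> exists y, G (x, y)).
  left; apply/card_leRP; exists (fun x y => G (x, y)); split.
    by move=> x /tA[y Gxy]; exists y => //; have [] := GAB _ Gxy.
  by move=> x x' y _ _; exact: Gl.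
have [tB|/existsNP[b /not_implyP[Bb Nb]]] :=
    pselect (forall y, B y -> exists x, G (x, y)).
  right; apply/card_leRP; exists (fun y x => G (x, y)); split.
    by move=> y /tB[x Gxy]; exists x => //; have [] := GAB _ Gxy.
  by move=> y y' x _ _; exact: Gr.
exfalso; apply: (Gmax (G `|` [set (a, b)])).
  split; first exact: subsetUl.
  by move=> /(_ (a, b)) h; apply: Na; exists b; apply: h; right.
split.
- by move=> [x y] [/GAB//|[-> ->]].
- move=> x x' y [g|[-> ->]] [g'|[]].
  + exact: Gl g g'.
  + by move=> _ e; case: Nb; exists x; rewrite -e.
  + by case: Nb; exists x'.
  + by move=> ->.
- move=> x y y' [g|[-> ->]] [g'|[]].
  + exact: Gr g g'.
  + by move=> e _; case: Na; exists y; rewrite -e.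
  + by case: Na; exists y'.
  + by move=> ->.
Qed.

Lemma card_leNgt T U (A : set T) (B : set U) : ~ (A #<= B) -> B #<= A.
Proof. by case: (card_le_total A B). Qed.

Lemma card_le_subset T U (A : set T) (B : set U) :
  A #<= B -> exists2 Y, Y `<=` B & Y #= A.
Proof.
move=> /card_leRP[R [tR iR]].
pose f (x : T) (h : A x) := s2val (cid2 (tR x h)).
exists [set y | exists x (h : A x), y = f x h].
  by move=> _ [x [h ->]]; exact: (s2valP (cid2 (tR x h))).
have fR x h : R x (f x h) by exact: (s2valP' (cid2 (tR x h))).
apply/card_eqPle; split; apply/card_leRP.
  exists (fun y x => exists h : A x, y = f x h); split.
    by move=> _ [x [h ->]]; exists x => //; exists h.
  by move=> y y' x _ _ [h ->] [h' ->]; congr f; exact: Prop_irrelevance.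
exists (fun x y => exists h : A x, y = f x h); split.
  by move=> x h; exists (f x h); [exists x, h|exists h].
move=> x x' y _ _ [h ->] [h' e]; apply: (iR _ _ (f x h)) => //.
by rewrite e.
Qed.

Lemma card_le_funT T U (B : set U) : [set: T] #<= B ->
  exists f : T -> U, (forall x, B (f x)) /\ injective f.
Proof.
move=> /card_leRP[R [tR iR]].
have [f fP] := choice (fun x => let: ex_intro2 y a b := tR x I in
  ex_intro (fun y => B y /\ R x y) y (conj a b)).
exists f; split=> [x|x y e]; first by have [] := fP x.
by apply: (iR _ _ (f x)) => //; [have [] := fP x|rewrite e; have [] := fP y].
Qed.

Lemma infinite_two T (X : set T) : infinite_set X ->
  exists a b, [/\ X a, X b & a <> b].
Proof.
move=> /infiniteP /card_leRP[R [tR iR]].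
have [a Xa Ra] := tR 0 I; have [b Xb Rb] := tR 1 I.
exists a, b; split=> // ab; rewrite ab in Ra.
by have := iR 0 1 b I I Ra Rb.
Qed.

Lemma card_leU_square T U (A B : set T) (X : set U) :
  infinite_set X -> X `*` X #<= X -> A #<= X -> B #<= X -> A `|` B #<= X.
Proof.
move=> /infinite_two[a [b [Xa Xb ab]]] X2 /card_leRP[R [tR iR]].
move=> /card_leRP[Q [tQ iQ]]; apply: card_le_trans X2.
apply/card_leRP; exists (fun x p => (A x /\ R x p.1 /\ p.2 = a) \/
  (~ A x /\ Q x p.1 /\ p.2 = b)); split.
  move=> x ABx; have [Ax|nAx] := pselect (A x).
    by have [y Xy xy] := tR _ Ax; exists (y, a) => //; left.
  have [//|Bx] := ABx.
  by have [y Xy xy] := tQ _ Bx; exists (y, b) => //; right.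
move=> x x' [y c] /= ABx ABx' [[Ax [xy e]]|[nAx [xy e]]] [[Ax' [xy' e']]|[nAx' [xy' e']]].
- exact: iR xy xy'.
- by case: ab; rewrite -e -e'.
- by case: ab; rewrite -e -e'.
- by case: ABx => // Bx; case: ABx' => // Bx'; exact: iQ xy xy'.
Qed.

(** An injection of the square of [X] into [X], kept as a graph so that inclusion is the order for
    Zorn's lemma. As in [card_leRP], totality and injectivity suffice. *)
Definition square_graph T (A : set T) (G : set (T * T * T)) (X : set T) :=
  [/\ X `<=` A, infinite_set X, (forall p, G p -> [/\ X p.1.1, X p.1.2 & X p.2]),
      (forall x y, X x -> X y -> exists z, G (x, y, z)) &
      (forall p p' z, G (p, z) -> G (p', z) -> p = p')].

Lemma square_graph_bigcup T (A : set T) (F : set (set (T * T * T))) :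
  F !=set0 -> total_on F subset ->
  (forall G, F G -> exists X, square_graph A G X) ->
  exists X, square_graph A (\bigcup_(G in F) G) X.
Proof.
move=> [G0 FG0] Ft FP.
have [X0 [X0A X0i X0G X0t _]] := FP _ FG0.
(* The base set of the union is recovered from the diagonals of the graphs. *)
exists [set x | exists2 G, F G & exists z, G (x, x, z)]; split.
- move=> x [G /FP[X [XA _ XG _ _]] [z /XG[/= ? _ _]]].
  exact: XA.
- move=> h; apply: X0i; apply: sub_finite_set h => x X0x.
  by exists G0 => //; exact: X0t.
- move=> [[x y] z] [G FG Gp]; have [X [_ _ XG Xt _]] := FP _ FG.
  by have [/= Xx Xy Xz] := XG _ Gp; split; exists G => //; exact: Xt.
- move=> x y [G FG [z Gz]] [G' FG' [z' Gz']].
  suff [H [FH Hx Hy]] : exists H, [/\ F H, H (x, x, z) & H (y, y, z')].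
    have [X [_ _ XH Xt _]] := FP _ FH.
    have [Xx _ _] := XH _ Hx; have [Xy _ _] := XH _ Hy.
    by have [u] := Xt x y Xx Xy; exists u, H.
  by case: (Ft _ _ FG FG') => s; [exists G'|exists G]; split=> //; exact: s.
- move=> p p' z [G FG Gp] [G' FG' Gp']; case: (Ft _ _ FG FG') => s.
    by have [X [_ _ _ _ h]] := FP _ FG'; exact: h (s _ Gp) Gp'.
  by have [X [_ _ _ _ h]] := FP _ FG; exact: h Gp (s _ Gp').
Qed.

(** Take a maximal graph, with base set [X]. If [A] minus [X] were larger than [X], it would contain
    a copy [Z] of [X], and the new pairs from the union of [X] and [Z] could be sent injectively
    into [Z], against maximality. So [A] is no larger than [X]. *)
Lemma card_square T (A : set T) : infinite_set A -> A `*` A #<= A.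
Proof.
move=> Ai.
have [Y YA Yn] : exists2 Y, Y `<=` A & Y #= [set: nat].
  exact: card_le_subset ((infiniteP A).1 Ai).
have /card_eqPle[Yle leY] := Yn.
have /card_leRP[R0 [tR0 iR0]] : Y `*` Y #<= Y.
  apply: card_le_trans leY; apply: card_le_trans (card_leX Yle Yle) _.
  apply: card_le_trans (card_leT _) _.
  by have /card_eqPle[] := card_nat2.
pose G0 : set (T * T * T) := [set p | [/\ Y p.1.1, Y p.1.2, Y p.2 & R0 p.1 p.2]].
have G0P : square_graph A G0 Y.
  split=> //.
  - by apply/infiniteP.
  - by move=> p [].
  - by move=> x y Yx Yy; have [z Yz xyz] := tR0 (x, y) (conj Yx Yy); exists z.
  - by move=> p p' z [/= a b c d] [/= a' b' c' d']; apply: iR0 d d'.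
(* Adding [G0] makes the union of the empty chain admissible. *)
pose P : set (set (T * T * T)) := [set G | exists X, square_graph A (G `|` G0) X].
have [F FP Ft|G [[X XG] Gmax]] := @Zorn_bigcup _ P.
  pose F' := [set G `|` G0 | G in F] `|` [set G0].
  rewrite /P /=; have -> : (\bigcup_(X in F) X) `|` G0 = \bigcup_(G in F') G.
    apply/seteqP; split=> [p [[G FG Gp]|G0p]|p [H [[G FG <-]|->]]].
    - by exists (G `|` G0); [left; exists G|left].
    - by exists G0 => //; right.
    - by move=> [Gp|]; [left; exists G|right].
    - by right.
  apply: square_graph_bigcup.
  - by exists G0; right.
  - move=> _ _ [[G FG <-]|->] [[G' FG' <-]|->].
    + by case: (Ft _ _ FG FG') => s; [left|right]; exact: setSU.
    + by right; exact: subsetUr.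
    + by left; exact: subsetUr.
    + by left.
  - move=> _ [[G FG <-]|->]; first exact: FP.
    by exists Y.
have [XA Xi XGs XGt XGi] := XG.
have X2 : X `*` X #<= X.
  apply/card_leRP; exists (fun p z => (G `|` G0) (p, z)); split.
    by move=> [x y] [/= Xx Xy]; have [z h] := XGt _ _ Xx Xy; exists z => //; case: (XGs _ h).
  by move=> p p' z _ _; exact: XGi.
have [AX|/card_leNgt XAX] := pselect (A `\` X #<= X).
  have AleX : A #<= X.
    have -> : A = X `|` (A `\` X).
      apply/seteqP; split=> [x Ax|x [/XA|[]] //].
      by have [Xx|nXx] := pselect (X x); [left|right].
    exact: card_leU_square.
  apply: card_le_trans (card_leX AleX AleX) _; apply: card_le_trans X2 _.
  exact: subset_card_le.
have [Z ZAX /card_eqPle[ZX XZ]] := card_le_subset XAX.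
pose X' := X `|` Z.
have X'X : X' #<= X by exact: card_leU_square.
have /card_leRP[R [tR iR]] : X' `*` X' #<= Z.
  apply: card_le_trans XZ; apply: card_le_trans X2; exact: card_leX.
pose H : set (T * T * T) := [set p | [/\ X' p.1.1, X' p.1.2, ~ (X p.1.1 /\ X p.1.2), Z p.2 & R p.1 p.2]].
have ZnX z : Z z -> ~ X z by move=> /ZAX[].
exfalso; apply: (Gmax (G `|` H)).
  split; first exact: subsetUl.
  have /infinite_setN0[z Zz] : infinite_set Z.
    by apply/infiniteP; apply: card_le_trans XZ; exact/infiniteP.
  have [w Zw zzw] := tR (z, z) (conj (or_intror Zz) (or_intror Zz)).
  move=> /(_ (z, z, w)) h; have [] := XGs (z, z, w).
    left; apply: h; right; split=> //=; [by right|by right|].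
    by move=> [/(ZnX _ Zz)].
  by move=> /(ZnX _ Zz).
exists X'; have -> : G `|` H `|` G0 = (G `|` G0) `|` H by rewrite setUAC.
split.
- by move=> x [/XA|/ZAX[]].
- by move=> h; apply: Xi; apply: sub_finite_set h; exact: subsetUl.
- move=> p [/XGs[a b c]|[a b _ c _]]; split=> //; by [left|right].
- move=> x y X'x X'y; have [[Xx Xy]|nXxy] := pselect (X x /\ X y).
    by have [z] := XGt _ _ Xx Xy; exists z; left.
  have [z Zz xyz] := tR (x, y) (conj X'x X'y).
  by exists z; right.
- move=> p p' z [g|[/= a b c d e]] [g'|[/= a' b' c' d' e']].
  + exact: XGi g g'.
  + by case: (XGs _ g) => _ _ /(ZnX _ d').
  + by case: (XGs _ g') => _ _ /(ZnX _ d).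
  + exact: iR e e'.
Qed.

Lemma card_leU T U (A B : set T) (X : set U) :
  infinite_set X -> A #<= X -> B #<= X -> A `|` B #<= X.
Proof. by move=> Xi; apply: card_leU_square => //; exact: card_square. Qed.

Lemma card_leX_inf T T' U (A : set T) (B : set T') (X : set U) :
  infinite_set X -> A #<= X -> B #<= X -> A `*` B #<= X.
Proof.
by move=> Xi AX BX; apply: card_le_trans (card_leX AX BX) _; exact: card_square.
Qed.

Lemma card_le_bigcup I T U (D : set I) (F : I -> set T) (X : set U) :
  infinite_set X -> D #<= X -> (forall i, D i -> F i #<= X) ->
  \bigcup_(i in D) F i #<= X.
Proof.
move=> Xi DX FX; apply: card_le_trans (card_square Xi).
apply: card_le_trans (card_leX DX (card_lexx X)).
pose R i := if pselect (D i) is left h then sval (cid ((card_leRP _ _).1 (FX i h)))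
            else fun _ _ => False.
have RP i : D i -> (forall x, F i x -> exists2 y, X y & R i x y) /\
    (forall x x' y, F i x -> F i x' -> R i x y -> R i x' y -> x = x').
  by move=> Di; rewrite /R; case: pselect => // h; exact: (svalP (cid ((card_leRP _ _).1 (FX i h)))).
apply/card_leRP; exists (fun x p => [/\ D p.1, F p.1 x & R p.1 x p.2]); split.
  by move=> x [i Di Fix]; have [t _] := RP _ Di; have [y Xy xy] := t _ Fix; exists (i, y).
by move=> x x' [i y] _ _ [/= Di Fix a] [_ Fix' b]; have [_] := RP _ Di; apply; eassumption.
Qed.

Lemma card_le_infinite T U (A : set T) (X : set U) :
  A #<= X -> infinite_set A -> infinite_set X.
Proof. by move=> h /infiniteP i; apply/infiniteP; exact: card_le_trans h. Qed.

(** * Well-orders *)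

Definition is_wo T (lt : T -> T -> Prop) :=
  [/\ well_founded lt, (forall x y z, lt x y -> lt y z -> lt x z) &
      (forall x y, [\/ lt x y, x = y | lt y x])].

Lemma wf_min T (lt : T -> T -> Prop) (P : set T) : well_founded lt ->
  P !=set0 -> exists2 x, P x & forall y, lt y x -> ~ P y.
Proof.
move=> wf [x]; elim/(well_founded_ind wf): x => x IH Px.
have [h|/existsNP[y /not_implyP[yx /contrapT Py]]] :=
  pselect (forall y, lt y x -> ~ P y); first by exists x.
exact: IH yx Py.
Qed.

Lemma wf_irr T (lt : T -> T -> Prop) x : well_founded lt -> ~ lt x x.
Proof. by move=> wf; elim/(well_founded_ind wf): x => x IH /[dup] /IH. Qed.

(** Recursion with choices. The next value only has to exist when all earlier ones are correct, so
    the invariants of a construction can be put into [Q]. *)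
Lemma wf_rec (X Y : Type) (lt : X -> X -> Prop) (y0 : Y)
    (Q : X -> (X -> Y) -> Y -> Prop) : well_founded lt ->
  (forall x h h' y, (forall z, lt z x -> h z = h' z) -> Q x h y -> Q x h' y) ->
  (forall x h, (forall z, lt z x -> Q z h (h z)) -> exists y, Q x h y) ->
  exists h, forall x, Q x h (h x).
Proof.
move=> wf Qloc Qtot.
pose ext x (r : forall z, lt z x -> Y) z :=
  if pselect (lt z x) is left h then r z h else y0.
pose F x (r : forall z, lt z x -> Y) : Y :=
  if pselect (exists y, Q x (ext x r) y) is left h then sval (cid h) else y0.
pose h := Fix wf (fun=> Y) F.
have hE x : h x = F x (fun z _ => h z).
  rewrite /h Fix_eq // => {}x f g fg; congr F.
  by apply: functional_extensionality_dep => z; apply: functional_extensionality_dep => p.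
have extE x z : lt z x -> ext x (fun z _ => h z) z = h z.
  by move=> zx; rewrite /ext; case: pselect.
exists h => x; elim/(well_founded_ind wf): x => x IH.
rewrite hE /F; case: pselect => [e|[]].
  by apply: (Qloc _ _ _ _ (extE x)); exact: svalP.
have [y Qy] := Qtot x h IH.
by exists y; apply: Qloc Qy => z zx; rewrite extE.
Qed.

Lemma wo_exists T : exists lt : T -> T -> Prop, is_wo lt.
Proof.
have [R Rwo] := wochoice.well_ordering_principle {classic T}.
have Rmin (P : set T) : P !=set0 -> exists2 x, P x & forall y, P y -> R x y.
  move=> [x Px]; have [|z [[zP lz] _]] := Rwo [pred y | `[< P y >]].
    by exists x; apply/asboolP.
  exists z; first by move/asboolP: zP.
  by move=> y Py; apply: lz; apply/asboolP.
have Rtot x y : R x y \/ R y x.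
  have [z [->|->] h] := Rmin [set x; y] (ex_intro _ x (or_introl erefl)).
    by left; apply: h; right.
  by right; apply: h; left.
have Ranti x y : R x y -> R y x -> x = y.
  move=> xy yx; have [|z [_ zu]] := Rwo [pred z | (z == x) || (z == y)].
    by exists x; rewrite inE eqxx.
  have Rxx u : R u u by case: (Rtot u u).
  rewrite -(zu x); last first.
    by split=> [|u]; rewrite inE ?eqxx // => /orP[]/eqP->.
  apply: zu; split=> [|u]; rewrite inE ?eqxx ?orbT // => /orP[]/eqP-> //.
have Rtr x y z : R x y -> R y z -> R x z.
  move=> xy yz.
  have [u [[->|->]|->] h] := Rmin [set x; y; z] (ex_intro _ x (or_introl (or_introl erefl))).
  - by apply: h; right.
  - have yx : R y x by apply: h; left; left.
    by rewrite (Ranti _ _ xy yx).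
  - have zy : R z y by apply: h; left; right.
    by rewrite -(Ranti _ _ yz zy).
exists (fun x y => R x y /\ x <> y); split.
- move=> x; apply: contrapT => nx.
  have [z nz h] := Rmin [set z | ~ Acc (fun x y => R x y /\ x <> y) z] (ex_intro _ x nx).
  apply: nz; constructor => y [yz nyz]; apply: contrapT => /h zy.
  exact/nyz/Ranti.
- move=> x y z [xy nxy] [yz nyz]; split; first exact: Rtr xy yz.
  by move=> e; apply: nxy; apply: Ranti => //; rewrite e.
- move=> x y; have [->|ne] := pselect (x = y); first exact: Or32.
  by case: (Rtot x y) => h; [apply: Or31|apply: Or33; split=> // e; exact: ne].
Qed.

(** If some segment has the size of [T], take the least such one and pull its order back along an
    injection of [T] into it. *)
Lemma wo_initial T : exists lt : T -> T -> Prop, is_wo lt /\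
  forall j, ~ ([set: T] #<= [set x | lt x j]).
Proof.
have [lt [wf tr tot]] := wo_exists T.
have [h|/existsNP[j /contrapT hj]] :=
  pselect (forall j, ~ ([set: T] #<= [set x | lt x j])); first by exists lt.
have [j0 /card_le_funT[f [fj0 fI]] j0min] :=
  wf_min wf (ex_intro (fun j => [set: T] #<= [set x | lt x j]) j hj).
exists (fun x y => lt (f x) (f y)); split; last first.
  move=> i; apply: contra_not (j0min _ (fj0 i)) => h; apply: card_le_trans h _.
  apply: (card_le_fun (f := f)) => // x y _ _; exact: fI.
split.
- move=> x; move: {2}(f x) (erefl (f x)) => y; elim/(well_founded_ind wf): y x => y IH x fx.
  by constructor => z; rewrite fx => zy; exact: IH zy _ erefl.
- by move=> x y z; exact: tr.
- by move=> x y; case: (tot (f x) (f y)) => [h|/fI h|h]; [apply: Or31|apply: Or32|apply: Or33].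
Qed.

(** Otherwise [X] contains a copy [Y] of [B]. If [Y] is bounded in [X], then [B] is no larger than
    [A]; if not, the closed segments up to points of [Y] cover [X]. *)
Lemma card_le_initial T U V (lt : T -> T -> Prop) (X : set T) (A : set U) (B : set V) :
  is_wo lt -> infinite_set B -> ~ (B #<= A) ->
  (forall x, X x -> X `&` [set y | lt y x] #<= A) -> X #<= B.
Proof.
move=> [wf tr tot] Bi BA XA; apply: contrapT => XB.
have [Y YX /card_eqPle[YB BY]] := card_le_subset (card_leNgt XB).
have [[x Xx Yx]|nY] := pselect (exists2 x, X x & forall y, Y y -> lt y x).
  apply: BA; apply: card_le_trans BY _; apply: card_le_trans (XA _ Xx).
  by apply: subset_card_le => y Yy; split; [exact: YX|exact: Yx].
apply: XB; have : X `<=` \bigcup_(y in Y) ((X `&` [set z | lt z y]) `|` [set y]).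
  move=> x Xx; have [y Yy yx] : exists2 y, Y y & ~ lt y x.
    apply: contrapT => h; apply: nY; exists x => // y Yy.
    by apply: contrapT => yx; apply: h; exists y.
  by exists y => //; case: (tot x y) => [xy|->|//]; [left|right].
move=> /subset_card_le/card_le_trans; apply; apply: card_le_bigcup => // y Yy.
apply: card_leU => //; first exact: card_le_trans (XA _ (YX _ Yy)) (card_leNgt BA).
by apply: card_le_trans YB; apply: subset_card_le => _ ->.
Qed.

Definition lexi A B (ltA : A -> A -> Prop) (ltB : B -> B -> Prop) (p q : A * B) :=
  ltA p.1 q.1 \/ p.1 = q.1 /\ ltB p.2 q.2.

Lemma lexi_wo A B (ltA : A -> A -> Prop) (ltB : B -> B -> Prop) :
  is_wo ltA -> is_wo ltB -> is_wo (lexi ltA ltB).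
Proof.
move=> [wA tA oA] [wB tB oB]; split.
- move=> [a b]; elim/(well_founded_ind wA): a b => a IHa b.
  elim/(well_founded_ind wB): b => b IHb; constructor => -[a' b'] [/=h|/= [-> h]].
    exact: IHa.
  exact: IHb.
- move=> [a b] [a' b'] [a'' b''] [/= h|/= [-> h]] [/= h'|/= [<- h']].
  + by left; exact: tA h h'.
  + by left.
  + by left.
  + by right; split=> //; exact: tB h h'.
- move=> [a b] [a' b']; case: (oA a a') => [h|->|h].
  + by apply: Or31; left.
  + by case: (oB b b') => [h|->|h]; [apply: Or31; right|apply: Or32|apply: Or33; right].
  + by apply: Or33; left.
Qed.

(* Bernstein's induction: V j is too large to be exhausted by the elements labelled before (j, w). *)
Lemma label_all J W X (ltJ : J -> J -> Prop) (V : J -> set X) : is_wo ltJ ->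
  exists l : X -> option W, forall j,
    ~ (V j #<= [set j' | ltJ j' j \/ j' = j] `*` [set: W]) ->
    forall w, exists2 x, V j x & l x = Some w.
Proof.
move=> woJ; have [ltW woW] := wo_exists W.
have wo2 := lexi_wo woJ woW; have [wf2 _ tot2] := wo2.
pose big j := ~ (V j #<= [set j' | ltJ j' j \/ j' = j] `*` [set: W]).
have [||h hP] := @wf_rec (J * W) (option X) (lexi ltJ ltW) None
  (fun p h y => big p.1 -> exists x, [/\ y = Some x, V p.1 x &
     forall z, lexi ltJ ltW z p -> h z <> y]) wf2.
  move=> x h h' y hh' + b => /(_ b)[v [e Vv vP]]; exists v; split=> // z zx.
  by rewrite -hh' //; exact: vP.
  move=> [j w] h _; have [b|nb] := pselect (big j); last by exists None.
  have [x [Vx nx]] : exists x, V j x /\ ~ exists2 z, lexi ltJ ltW z (j, w) & h z = Some x.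
    apply: contrapT => nx; apply: b; apply/card_leRP.
    exists (fun x z => lexi ltJ ltW z (j, w) /\ h z = Some x); split.
      move=> x Vx; have [z zjw hz] : exists2 z, lexi ltJ ltW z (j, w) & h z = Some x.
        by apply: contrapT => n; apply: nx; exists x.
      by exists z => //; split=> //; case: zjw => [|[]] /=; [left|right].
    by move=> x x' z _ _ [_ e] [_]; rewrite e => -[].
  exists (Some x) => _; exists x; split=> // z zl e.
  by apply: nx; exists z.
exists (fun x => if pselect (exists p, big p.1 /\ h p = Some x) is left e
                 then Some (sval (cid e)).2 else None) => j bj w.
have [x [hx Vx hlt]] := hP (j, w) bj.
exists x => //; case: pselect => [e|[]]; last by exists (j, w).
case: cid => -[j' w'] [/= bj' hx']; case: (tot2 (j, w) (j', w')) => [l|[_ -> //]|l].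
  have [x' [e' _ /(_ _ l)[]]] := hP (j', w') bj'.
  by rewrite hx hx'.
by have [] := hlt _ l; rewrite hx hx'.
Qed.

(** The product is no larger than the larger of its two factors, and both are smaller than [T]. This
    is the bound under which [label_all] applies. *)
Lemma initial_prod T W (lt : T -> T -> Prop) :
  (forall j, ~ ([set: T] #<= [set x | lt x j])) ->
  infinite_set [set: W] -> ~ ([set: T] #<= [set: W]) ->
  forall j, ~ ([set: T] #<= [set x | lt x j \/ x = j] `*` [set: W]).
Proof.
move=> ini Wi TW j; set B := [set x | _].
case: (card_le_total B [set: W]) => h.
  apply: contra_not TW => /card_le_trans; apply.
  exact: card_leX_inf Wi h (card_lexx _).
have Bi := card_le_infinite h Wi.
have Be : B = [set x | lt x j] `|` [set j] by apply/seteqP; split.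
have Li : infinite_set [set x | lt x j].
  move=> fin; apply: Bi; rewrite Be finite_setU; split=> //; exact: finite_set1.
have [k Lk] := infinite_setN0 Li.
have Bj : B #<= [set x | lt x j].
  rewrite Be; apply: card_leU => //.
  by apply: (card_le_fun (f := fun=> k)) => // x x' -> ->.
move=> TB; apply: (ini j); apply: card_le_trans TB _; apply: card_le_trans Bj.
exact: card_leX_inf Bi (card_lexx _) h.
Qed.

(** * Singular cardinals of countable cofinality *)

Section SingularCardinal.
Variables (d : Order.disp_t) (mu : orderType d).
Hypothesis mu_sing : is_singular_cardinal mu.
Hypothesis mu_cof : is_cofinality mu [set: nat].

Local Open Scope order_scope.

Definition seg (x : mu) : set mu := [set y | y < x].

Lemma mu_min (P : set mu) : P !=set0 -> exists2 x, P x & forall y, P y -> x <= y.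
Proof.
case: mu_sing => -[wo _] _ _ [x Px].
have [|z [[zP lz] _]] := wo [pred y | `[< P y >]]; first by exists x; exact/asboolP.
exists z; first by move/asboolP: zP.
by move=> y Py; apply: lz; exact/asboolP.
Qed.

Lemma mu_wo : is_wo (fun x y : mu => x < y).
Proof.
split.
- move=> x; apply: contrapT => nx.
  have [z nz h] := mu_min (ex_intro (fun z => ~ Acc (fun x y : mu => x < y) z) x nx).
  apply: nz; constructor => y yz; apply: contrapT => /h.
  by rewrite leNgt yz.
- by move=> x y z; exact: lt_trans.
- by move=> x y; case: (ltgtP x y) => h; [apply: Or31|apply: Or33|apply: Or32].
Qed.

Lemma seg_lt x : ~ ([set: mu] #<= seg x).
Proof. by case: mu_sing => -[_ h] _ _; case: (h x). Qed.

Lemma seg_le x y : x <= y -> seg x #<= seg y.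
Proof. by move=> xy; apply: subset_card_le => z zx; exact: lt_le_trans zx xy. Qed.

(** A singular cardinal exceeds its cofinality, which is countable here. *)
Lemma mu_uncountable : ~ ([set: mu] #<= [set: nat]).
Proof.
case: mu_sing => _ _ [K [[A Acof AK] Kle] [_ nK]] h.
case: mu_cof => -[B Bcof /card_eqPle[_ nB]] _.
case: mu_cof => _ /(_ _ Acof) nA; apply: nK; apply: card_le_trans h _.
by apply: card_le_trans nA _; case/card_eqPle: AK.
Qed.

Lemma mu_cofinal_seq : exists a : nat -> mu, forall x, exists n, x <= a n.
Proof.
case: mu_cof => -[A Acof /card_eqPle[/card_leRP[R [tR iR]] _]] _.
have [x0 Ax0] : exists x, A x.
  have [_ ninf _] := mu_sing.
  have [x _] := infinite_setN0 ninf.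
  by have [y Ay _] := Acof x; exists y.
pose a n := if pselect (exists x, A x /\ R x n) is left e then sval (cid e) else x0.
exists a => x; have [y Ay xy] := Acof x; have [n _ yn] := tR _ Ay.
exists n; rewrite /a; case: pselect => [e|[]]; last by exists y.
by case: cid => z [Az zn] /=; rewrite (iR z y n).
Qed.

Lemma card_mu_le T (K : set T) : infinite_set K -> (forall x, seg x #<= K) ->
  [set: mu] #<= K.
Proof.
move=> Ki h; have [a aP] := mu_cofinal_seq.
have : [set: mu] `<=` \bigcup_n (seg (a n) `|` [set a n]).
  move=> x _; have [n] := aP x; rewrite le_eqVlt => /orP[/eqP ->|xn].
    by exists n => //; right.
  by exists n => //; left.
move=> /subset_card_le/card_le_trans; apply; apply: card_le_bigcup => //.
  exact/infiniteP.
move=> n _; apply: card_leU => //.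
have [k Kk] := infinite_setN0 Ki.
by apply: (card_le_fun (f := fun=> k)) => // x x' -> ->.
Qed.

Lemma seg_above T (K : set T) : infinite_set K -> ~ ([set: mu] #<= K) ->
  exists x, ~ (seg x #<= K).
Proof.
move=> Ki nK; apply: contrapT => h; apply: nK; apply: card_mu_le => // x.
by apply: contrapT => hx; apply: h; exists x.
Qed.

Lemma block_bounds : exists m : nat -> mu,
  [/\ ~ (seg (m 0) #<= [set: nat]),
      forall n, ~ (seg (m n.+1) #<= seg (m n)),
      forall n, m n < m n.+1 & forall x, exists n, x < m n].
Proof.
have [a aP] := mu_cofinal_seq.
have [w0 w0P] := seg_above infinite_nat mu_uncountable.
(* Above [w0] all segments are infinite, so [seg_above] applies to them. *)
have nxt (x : mu) : exists y, w0 <= x -> ~ (seg y #<= seg x).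
  have [w0x|] := boolP (w0 <= x); last by exists w0.
  have [y hy] : exists y, ~ (seg y #<= seg x).
    apply: seg_above; last exact: seg_lt.
    apply: card_le_infinite (seg_le w0x) _ => /finite_set_countable.
    exact: w0P.
  by exists y.
have [s sP] := choice nxt.
(* The maximum with [a n'] makes the sequence cofinal. *)
pose m := fix m n := if n is n'.+1 then s (Order.max (m n') (a n')) else w0.
have gt x y : ~ (seg x #<= seg y) -> y < x.
  by move=> h; rewrite ltNge; apply/negP => /seg_le.
have mw n : w0 <= m n.
  elim: n => //= n IH; apply: ltW; apply: le_lt_trans (gt _ _ (sP _ _)); rewrite le_max IH //.
have mS n : ~ (seg (m n.+1) #<= seg (Order.max (m n) (a n))).
  by apply: sP; rewrite le_max mw.
exists m; split=> //.
- move=> n h; apply: (mS n); apply: card_le_trans h _; apply: seg_le.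
  by rewrite le_max lexx.
- by move=> n; apply: le_lt_trans (gt _ _ (mS n)); rewrite le_max lexx.
- move=> x; have [n xn] := aP x; exists n.+1; apply: le_lt_trans xn _.
  by apply: le_lt_trans (gt _ _ (mS n)); rewrite le_max lexx orbT.
Qed.

End SingularCardinal.

(** * Blocks of mu and small sets *)

Section Blocks.
Variables (d : Order.disp_t) (mu : orderType d).

Local Open Scope order_scope.

(* The cardinalities of the segments below m 0 < m 1 < ... increase strictly to mu.
   Using elements of mu as names of cardinals avoids a type of cardinals. *)
Record block_seq (m : nat -> mu) : Prop := BlockSeq {
  bs_sing : is_singular_cardinal mu;
  bs_cof : is_cofinality mu [set: nat];
  bs_m0 : ~ (seg (m 0) #<= [set: nat]);
  bs_mS : forall n, ~ (seg (m n.+1) #<= seg (m n));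
  bs_lt : forall n, m n < m n.+1;
  bs_ex : forall x, exists n, x < m n }.

Variable m : nat -> mu.

Definition kap n : set mu := seg (m n).

Definition blk k : set mu := [set x | x < m k /\ forall i, (i < k)%N -> m i <= x].

(** A uniform bound on the blocks suits arguments that work block by block; [smallP] shows that it
    means fewer than [mu] elements. *)
Definition small (q : set mu) := exists n, forall k, q `&` blk k #<= kap n.

Hypothesis mP : block_seq m.

Lemma m_le n n' : (n <= n')%N -> m n <= m n'.
Proof.
elim: n' => [|n' IH]; first by rewrite leqn0 => /eqP ->.
rewrite leq_eqVlt => /orP[/eqP -> //|]; rewrite ltnS => /IH/le_trans; apply.
exact/ltW/(bs_lt mP).
Qed.

Lemma kap_le n n' : (n <= n')%N -> kap n #<= kap n'.
Proof. by move=> /m_le /seg_le. Qed.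

Lemma kap_lt n n' : (n < n')%N -> ~ (kap n' #<= kap n).
Proof. by move=> nn' h; apply: (bs_mS mP (n := n)); apply: card_le_trans (kap_le nn') h. Qed.

Lemma kap_infinite n : infinite_set (kap n).
Proof.
apply: card_le_infinite (kap_le (leq0n n)) _ => /finite_set_countable.
exact: bs_m0 mP.
Qed.

Lemma nat_kap n : [set: nat] #<= kap n.
Proof. exact/infiniteP/kap_infinite. Qed.

Lemma blk_ex x : exists k, blk k x.
Proof.
have h := bs_ex mP x; case: (ex_minnP h) => k xk kmin; exists k; split=> // i ik.
by rewrite leNgt; apply/negP => /kmin; rewrite leqNgt ik.
Qed.

Lemma blk_uniq x k k' : blk k x -> blk k' x -> k = k'.
Proof.
move=> [xk h] [xk' h']; case: (ltngtP k k') => // kk'.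
  by have := h' _ kk'; rewrite leNgt xk.
by have := h _ kk'; rewrite leNgt xk'.
Qed.

Lemma blk_kap k : blk k `<=` kap k. Proof. by move=> x []. Qed.

Lemma small_sub p q : p `<=` q -> small q -> small p.
Proof.
move=> pq [n h]; exists n => k; apply: card_le_trans (h k).
by apply: subset_card_le; exact: setSI.
Qed.

Lemma small_kap n q : q #<= kap n -> small q.
Proof.
by move=> h; exists n => k; apply: card_le_trans h; apply: subset_card_le => x [].
Qed.

Lemma small0 : small set0.
Proof. by apply: (@small_kap 0); exact: card_ge0. Qed.

Lemma smallU p q : small p -> small q -> small (p `|` q).
Proof.
move=> [n h] [n' h']; exists (maxn n n') => k; rewrite setIUl; apply: card_leU.
- exact: kap_infinite.
- by apply: card_le_trans (h k) (kap_le _); rewrite leq_maxl.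
- by apply: card_le_trans (h' k) (kap_le _); rewrite leq_maxr.
Qed.

Lemma small_card n q : (forall k, q `&` blk k #<= kap n) -> q #<= kap n.
Proof.
move=> h; have : q `<=` \bigcup_k (q `&` blk k).
  by move=> x qx; have [k xk] := blk_ex x; exists k.
move=> /subset_card_le/card_le_trans; apply; apply: card_le_bigcup => //.
- exact: kap_infinite.
- exact: nat_kap.
- by move=> k _; exact: h.
Qed.

(** A uniform bound passes to the union of the countably many blocks. Conversely, a set that is not
    small is at least as large as every [kap n], and [mu] is a countable union of segments of these
    sizes. *)
Lemma smallP q : small q <-> ~ ([set: mu] #<= q).
Proof.
split=> [[n /small_card h] muq|nq].
  by apply: (seg_lt (bs_sing mP) (x := m n)); exact: card_le_trans h.
apply: contrapT => ns.
have kq n : kap n #<= q.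
  apply: card_leNgt => qn; apply: ns; exact: small_kap qn.
apply: nq; apply: (card_mu_le (bs_sing mP) (bs_cof mP)).
  exact: card_le_infinite (kq 0) (@kap_infinite 0).
move=> x; have [n xn] := bs_ex mP x; apply: card_le_trans (kq n).
exact/seg_le/ltW.
Qed.

Lemma largeT : ~ small setT.
Proof. by move=> /smallP; apply; exact: card_lexx. Qed.

Lemma small_finite_blocks q N : (forall x k, q x -> blk k x -> (k < N)%N) -> small q.
Proof.
move=> h; apply: (@small_kap N); apply: subset_card_le => x qx.
have [k xk] := blk_ex x; apply: lt_le_trans (proj1 xk) _.
by apply: m_le; apply: ltnW; exact: h xk.
Qed.

Lemma large_blk q N : ~ small q -> exists2 k, (N <= k)%N & ~ (q `&` blk k #<= kap N).
Proof.
move=> nq; have [k hk] : exists k, ~ (q `&` blk k #<= kap N).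
  by apply: contrapT => h; apply: nq; exists N => k; apply: contrapT => hk; apply: h; exists k.
exists k => //; rewrite leqNgt; apply/negP => kN; apply: hk.
apply: card_le_trans (kap_le (ltnW kN)).
by apply: subset_card_le => x [_]; exact: blk_kap.
Qed.

Lemma large_setD p q : ~ small q -> small p -> ~ small (q `\` p).
Proof.
move=> nq sp sqp; apply: nq; apply: small_sub (smallU sqp sp).
by move=> x qx; have [px|npx] := pselect (p x); [right|left].
Qed.

(** Make the sequence truly decreasing by finite intersections, and take from its [n]-th set one
    block where it exceeds [kap n]. The union of these pieces is large, and it lies in [q i] outside
    finitely many blocks. *)
Lemma pseudo_intersection (q : nat -> set mu) :
  (forall n, ~ small (q n)) -> (forall i n, (i <= n)%N -> small (q n `\` q i)) ->
  exists p, [/\ ~ small p, p `<=` q 0 & forall i, small (p `\` q i)].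
Proof.
move=> ql qd.
pose Q n : set mu := [set x | forall i, (i <= n)%N -> q i x].
have QD n j : (j <= n)%N -> small (q n `\` Q j).
  elim: j => [|j IH] jn.
    apply: small_sub (qd 0 n _) => // x [qx nQ]; split=> // h; apply: nQ => i.
    by rewrite leqn0 => /eqP ->.
  apply: small_sub (smallU (IH (ltnW jn)) (qd j.+1 n jn)) => x [qx nQ].
  have [Qx|] := pselect (Q j x); last by left.
  right; split=> // h; apply: nQ => i; rewrite leq_eqVlt => /orP[/eqP -> //|].
  by rewrite ltnS; exact: Qx.
have Ql n : ~ small (Q n).
  move=> /(large_setD (ql n)); apply.
  exact: small_sub (QD n n (leqnn n)).
have kP n : exists k, ~ (Q n `&` blk k #<= kap n).
  by have [k _ hk] := large_blk n (Ql n); exists k.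
have [k kkP] := choice kP.
exists (\bigcup_n (Q n `&` blk (k n))); split.
- move=> [n h]; apply: (kkP n); apply: card_le_trans (h (k n)).
  by apply: subset_card_le => x [Qx bx]; split=> //; exists n.
- by move=> x [n _ [Qx _]]; exact: Qx.
- move=> i; pose N := \max_(n < i) (k n).+1.
  apply: (@small_finite_blocks _ N) => x j [[n _ [Qx bx]] nq] /(blk_uniq bx) <-.
  case: (ltnP n i) => [ni|ni]; last by case: nq; exact: Qx.
  by rewrite (leq_trans (ltnSn _)) // (leq_bigmax (Ordinal ni)).
Qed.

End Blocks.

(** * The space of uniform ultrafilters *)

Section Topology.
Variables (d : Order.disp_t) (mu : orderType d) (m : nat -> mu).
Hypothesis mP : block_seq m.
Local Notation U := (uniform_ultrafilters mu).
Local Notation small := (small m).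

Lemma nbhs_basic (F : U) (A : set U) :
  nbhs F A <-> exists2 p, ultrafilter_sets F p & basic_open p `<=` A.
Proof.
rewrite nbhsE; split=> [[B [[D Dl <-] BF BA]]|[p Fp pA]].
  by have [p Dp Fp] := BF; exists p => // G Gp; apply: BA; exists p.
exists (basic_open p) => //; split=> //; exists [set p].
  by move=> _ ->; exact: uniform_ultrafilter_large Fp.
by rewrite bigcup_set1.
Qed.

Lemma uniform_not_small (F : U) p : ultrafilter_sets F p -> ~ small p.
Proof.
move=> Fp /(smallP mP) np; apply: (ultrafilter_uniform (p := p) _ Fp).
by split=> //; exact: card_leT.
Qed.

Lemma ultrafilter_and (F : U) p q :
  ultrafilter_sets F p -> ultrafilter_sets F q -> ultrafilter_sets F (p `&` q).
Proof. by have FU := ultrafilter_ultra F; exact: filterI. Qed.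

(** The sets that almost contain a member of [B] form a proper filter. It contains the complement of
    every small set, so an ultrafilter extending it is uniform. *)
Lemma uniform_extension (B : set (set mu)) : B !=set0 ->
  (forall p, B p -> ~ small p) ->
  (forall p q, B p -> B q -> exists2 r, B r & small (r `\` p) /\ small (r `\` q)) ->
  exists F : U, forall p q, B p -> small (p `\` q) -> ultrafilter_sets F q.
Proof.
move=> [p0 Bp0] Bl Bd.
pose G : set_system mu := [set q | exists2 p, B p & small (p `\` q)].
have GP : ProperFilter G.
  split; last split.
  - by move=> [p /Bl]; rewrite setD0.
  - by exists p0 => //; rewrite setDT; exact: small0.
  - move=> q q' [p Bp pq] [p' Bp' pq']; have [r Br [rp rp']] := Bd _ _ Bp Bp'.
    exists r => //; apply: small_sub (smallU mP (smallU mP rp rp') (smallU mP pq pq')).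
    move=> x [rx nq]; have [px|npx] := pselect (p x); last by left; left.
    have [p'x|np'x] := pselect (p' x); last by left; right.
    right; have [qx|nqx] := pselect (q x); last by left.
    by right; split=> // q'x; apply: nq.
  - move=> q q' qq' [p Bp pq]; exists p => //; apply: small_sub pq.
    by move=> x [px nq']; split=> // /qq'.
have [H [HU GH]] := ultraFilterLemma GP.
have Hu : is_uniform H.
  move=> p [_ /(smallP mP) sp] Hp.
  have HC : H (~` p).
    apply: GH; exists p0 => //; apply: small_sub sp.
    by move=> x [_ /contrapT].
  have /filter_not_empty[] : H set0 by rewrite -(setICr p); exact: filterI.
exists (UniformUltrafilter HU Hu) => p q Bp pq /=.
by apply: GH; exists p.
Qed.

Lemma basic_open_nonempty q : ~ small q -> exists F : U, ultrafilter_sets F q.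
Proof.
move=> nq; have [|||F FP] := @uniform_extension [set q].
- by exists q.
- by move=> _ ->.
- move=> _ _ -> ->; exists q => //; rewrite setDv.
  by split; exact: small0.
- by exists F; apply: (FP q) => //; rewrite setDv; exact: small0.
Qed.

Lemma nowhere_dense_avoid (N : set U) q : nowhere_dense N -> ~ small q ->
  exists p, [/\ ~ small p, p `<=` q & forall F : U, ultrafilter_sets F p -> ~ N F].
Proof.
move=> Nnd nq; have [F Fq] := basic_open_nonempty nq.
have : ~ nbhs F (closure N) by move=> h; have : interior (closure N) F by []; rewrite Nnd.
move=> h; have [G Gq nG] : exists2 G : U, ultrafilter_sets G q & ~ closure N G.
  apply: contrapT => n; apply: h; apply/nbhs_basic; exists q => // G Gq.
  by apply: contrapT => nG; apply: n; exists G.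
have [p Gp pN] : exists2 p, ultrafilter_sets G p & forall H : U, ultrafilter_sets H p -> ~ N H.
  apply: contrapT => n; apply: nG => A /nbhs_basic[p Gp pA].
  apply: contrapT => e; apply: n; exists p => // H Hp NH.
  by apply: e; exists H; split=> //; exact: pA.
exists (q `&` p); split.
- exact: uniform_not_small (ultrafilter_and Gq Gp).
- by move=> x [].
- move=> H Hqp; apply: pN; have HU := ultrafilter_ultra H.
  by apply: filterS Hqp => x [].
Qed.

Lemma nowhere_denseC (O : set U) :
  (forall F : U, O F -> nbhs F O) ->
  (forall q, ~ small q -> exists p, [/\ ~ small p, p `<=` q &
     forall F : U, ultrafilter_sets F p -> O F]) ->
  nowhere_dense (~` O).
Proof.
move=> Oo Od; apply/seteqP; split=> // F /nbhs_basic[p Fp pA].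
have [r [nr rp rO]] := Od _ (uniform_not_small Fp).
have [G Gr] := basic_open_nonempty nr.
have GU := ultrafilter_ultra G.
have Gp : ultrafilter_sets G p by exact: filterS rp Gr.
by have [H []] := pA G Gp _ (Oo _ (rO _ Gr)).
Qed.

End Topology.

(** * Well-orders of type omega1 and their countable chains *)

Record omega1_order (Om : Type) (lt : Om -> Om -> Prop) : Prop := Omega1Order {
  o1_wo : is_wo lt;
  o1_countable : forall a, [set c | lt c a] #<= [set: nat];
  o1_uncountable : ~ ([set: Om] #<= [set: nat]) }.

Lemma countable_enum T (A : set T) : A !=set0 -> A #<= [set: nat] ->
  exists e : nat -> T, (forall n, A (e n)) /\ forall x, A x -> exists n, e n = x.
Proof.
move=> [x0 Ax0] /card_leRP[R [tR iR]].
exists (fun n => if pselect (exists x, A x /\ R x n) is left h then sval (cid h) else x0).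
split=> [n|x Ax]; first by case: pselect => // h; case: cid => x [].
have [n _ xn] := tR _ Ax; exists n; case: pselect => [h|[]]; last by exists x.
by case: cid => y [Ay yn] /=; apply: iR yn xn.
Qed.

(** The running maxima [g] of an enumeration of the levels below [a] give a descending sequence of
    type omega, whose lower bound is below the whole chain. [top] serves when there are no levels
    below [a]. *)
Lemma countable_chain (Om Q : Type) (lt : Om -> Om -> Prop) (good : Q -> Prop)
    (le : Q -> Q -> Prop) (top : Q) (a : Om) (q : Om -> Q) :
  is_wo lt -> [set c | lt c a] #<= [set: nat] ->
  (forall x, le x x) -> (forall x y z, le x y -> le y z -> le x z) ->
  (forall f : nat -> Q, (forall n, good (f n)) ->
     (forall i n, (i <= n)%N -> le (f n) (f i)) ->
     exists2 p, good p & forall n, le p (f n)) ->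
  good top -> (forall c, lt c a -> good (q c)) ->
  (forall c c', lt c' c -> lt c a -> le (q c) (q c')) ->
  exists2 p, good p & forall c, lt c a -> le p (q c).
Proof.
move=> [wf tr tot] ca lexx letr sig gtop gq dq.
have [[c0 c0a]|ne] := pselect (exists c, lt c a); last first.
  by exists top => // c ca'; case: ne; exists c.
have [e [ea eS]] := countable_enum (ex_intro (fun c => lt c a) c0 c0a) ca.
pose mx x y := if pselect (lt x y) then y else x.
pose g := fix g n := if n is n'.+1 then mx (g n') (e n) else e 0.
have ga n : lt (g n) a.
  elim: n => [|n IH] /=; first exact: (ea 0).
  by rewrite /mx; case: pselect => h //=; exact: (ea n.+1).
have gS n : le (q (g n.+1)) (q (g n)).
  by rewrite /= /mx; case: pselect => // h; apply: dq => //; exact: ea.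
have ge n : le (q (g n)) (q (e n)).
  case: n => [|n] /=; first exact: lexx.
  rewrite /mx; case: pselect => h /=; first exact: lexx.
  case: (tot (g n) (e n.+1)) => [//|-> //|h']; exact: dq.
have [|i n|p gp pP] := sig (fun n => q (g n)).
- by move=> n; exact/gq/ga.
- elim: n => [|n IH]; first by rewrite leqn0 => /eqP ->.
  rewrite leq_eqVlt => /orP[/eqP -> //|]; rewrite ltnS => /IH; exact: letr (gS n).
exists p => // c /eS[n <-]; exact: letr (pP n) (ge n).
Qed.

Definition agree (Om E : Type) (lt : Om -> Om -> Prop) (a : Om) (S S' : Om -> E) :=
  forall c, lt c a -> S c = S' c.

(** A path of length [a] is represented by a total function. Truncation picks one representative of
    each class of [agree lt a], so that paths can be counted and labelled. *)
Definition trunc (Om E : Type) (lt : Om -> Om -> Prop) (e0 : E) (a : Om) (S : Om -> E) : Om -> E :=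
  fun c => if pselect (lt c a) is left _ then S c else e0.

Lemma truncE (Om E : Type) (lt : Om -> Om -> Prop) (e0 : E) a S : agree lt a (trunc lt e0 a S) S.
Proof. by move=> c ca; rewrite /trunc; case: pselect. Qed.

Lemma trunc_ext (Om E : Type) (lt : Om -> Om -> Prop) (e0 : E) a S S' :
  agree lt a S S' -> trunc lt e0 a S = trunc lt e0 a S'.
Proof.
move=> SS'; apply: functional_extensionality_dep => c; rewrite /trunc.
by case: pselect => // ca; exact: SS'.
Qed.

(** * Paths of countable length *)

Section StateMachine.
Variables (d : Order.disp_t) (mu : orderType d) (m : nat -> mu).
Hypothesis mP : block_seq m.
Local Notation U := (uniform_ultrafilters mu).
Local Notation small := (small m).
Variables (Om : Type) (lt : Om -> Om -> Prop).
Hypothesis omP : omega1_order lt.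

Lemma almost_trans (p q r : set mu) : small (p `\` q) -> small (q `\` r) -> small (p `\` r).
Proof.
move=> pq qr; apply: small_sub (smallU mP pq qr) => x [px nr].
by have [qx|nqx] := pselect (q x); [right|left].
Qed.

Lemma large_chain_bound (a : Om) (q : Om -> set mu) :
  (forall c, lt c a -> ~ small (q c)) ->
  (forall c c', lt c' c -> lt c a -> small (q c `\` q c')) ->
  exists2 p, ~ small p & forall c, lt c a -> small (p `\` q c).
Proof.
apply: (countable_chain (good := fun p => ~ small p) (le := fun p q => small (p `\` q))
          (top := setT) (o1_wo omP) (o1_countable omP a)).
- by move=> x; rewrite setDv; exact: small0.
- exact: almost_trans.
- by move=> f fl fd; have [p [pl _ pf]] := pseudo_intersection mP fl fd; exists p.
- exact: largeT.
Qed.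

(** By recursion, [h a] avoids [N a] and is almost contained in all earlier sets. The range of [h]
    then extends to a uniform ultrafilter. *)
Lemma nowhere_dense_omega1 (N : Om -> set U) :
  (forall a, nowhere_dense (N a)) -> exists F : U, forall a, ~ N a F.
Proof.
move=> Nnd; have [wf tr tot] := o1_wo omP.
have [||h hP] := @wf_rec Om (set mu) lt set0 (fun a h y => [/\ ~ small y,
    (forall c, lt c a -> small (y `\` h c)) &
    (forall F : U, ultrafilter_sets F y -> ~ N a F)]) wf.
- move=> a h h' y hh' [yl yd yN]; split=> // c ca; rewrite -hh' //; exact: yd.
- move=> a h IH; have [c ca|c c' c'c ca|p pl pd] := @large_chain_bound a h.
  + by have [] := IH c ca.
  + by have [_ + _] := IH c ca; apply.
  have [p' [p'l p'p p'N]] := nowhere_dense_avoid mP (Nnd a) pl.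
  exists p'; split=> // c ca; apply: small_sub (pd c ca) => x [/p'p]; by split.
have /infinite_setN0[a0 _] : infinite_set [set: Om].
  by move=> /finite_set_countable; exact: o1_uncountable omP.
have [|||F FP] := @uniform_extension _ _ _ mP (range h).
- by exists (h a0); exists a0.
- by move=> _ [a _ <-]; have [] := hP a.
- move=> _ _ [a _ <-] [b _ <-]; case: (tot a b) => [ab|->|ba].
  + exists (h b); first by exists b.
    by rewrite setDv; split; [have [_ + _] := hP b; apply|exact: small0].
  + by exists (h b); [exists b|rewrite setDv; split; exact: small0].
  + exists (h a); first by exists a.
    by rewrite setDv; split; [exact: small0|have [_ + _] := hP a; apply].
exists F => a; have [_ _] := hP a; apply; apply: (FP (h a)); first by exists a.
by rewrite setDv; exact: small0.
Qed.

Lemma nowhere_dense_cover_gt (C : set (set U)) :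
  nowhere_dense_cover C -> ~ (C #<= [set: Om]).
Proof.
move=> [Cnd Ccov] /card_leRP[R [tR iR]].
(* Levels that code no member of [C] get the empty set, which is nowhere dense. *)
pose N a : set U := if pselect (exists A, C A /\ R A a) is left h then sval (cid h) else set0.
have [a|F FN] := nowhere_dense_omega1 (N := N).
  rewrite /N; case: pselect => h /=; first by case: cid => A [CA _] /=; exact: Cnd.
  by rewrite /nowhere_dense closure0 interior0.
have [A CA FA] : (\bigcup_(A in C) A) F by rewrite Ccov.
have [a _ Aa] := tR _ CA; apply: (FN a); rewrite /N; case: pselect => [h|[]]; last by exists A.
by case: cid => B [CB Ba] /=; rewrite (iR _ _ _ CB CA Ba Aa).
Qed.

(* D a S e p: given the path S below level a, the set p decides that its entry at a is e. *)
Variables (E : Type) (D : Om -> (Om -> E) -> E -> set mu -> Prop).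

Definition decides a S p := forall c, lt c a -> D c S (S c) p.

Hypothesis Dloc : forall a S S' e p, agree lt a S S' -> D a S e p -> D a S' e p.
Hypothesis Duniq : forall a S e e' p p',
  D a S e p -> D a S e' p' -> ~ small (p `&` p') -> e = e'.

(** By induction on the level: agreement so far allows [Dloc] to move both decisions to the same
    path, where [Duniq] compares them. *)
Lemma decides_uniq a S S' p p' : decides a S p -> decides a S' p' ->
  ~ small (p `&` p') -> agree lt a S S'.
Proof.
have [wf tr _] := o1_wo omP.
move=> h h' l c; elim/(well_founded_ind wf): c => c IH ca.
apply: (@Duniq c S' _ _ p p') => //; last exact: h'.
by apply: Dloc (h _ ca) => b bc; apply: IH => //; exact: tr bc ca.
Qed.

(** The cover consists of the complements of the open dense sets [O w] of ultrafilters that meet the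
    label [w]. An ultrafilter meets at most one label through each [t], so lying in every [O w]
    would inject [W] into [T]. *)
Lemma machine_cover (T W : Type) (lev : T -> Om) (l : T -> (Om -> E) -> option W) :
  ~ ([set: W] #<= [set: T]) ->
  (forall t S S', agree lt (lev t) S S' -> l t S = l t S') ->
  (forall q w, ~ small q -> exists t S p, [/\ ~ small p, p `<=` q,
     decides (lev t) S p & l t S = Some w]) ->
  exists2 C : set (set U), nowhere_dense_cover C & C #<= [set: W].
Proof.
move=> WT lloc lall.
pose O w : set U := [set F | exists t S p, [/\ ultrafilter_sets F p, decides (lev t) S p & l t S = Some w]].
exists (range (fun w => ~` O w)); last exact: card_image_le.
split.
  move=> _ [w _ <-]; apply: (nowhere_denseC mP).
    move=> F [t [S [p [Fp tp lw]]]]; apply/nbhs_basic; exists p => // G Gp.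
    by exists t, S, p.
  move=> q /(lall q w)[t [S [p [pl pq tp lw]]]]; exists p; split=> // F Fp.
  by exists t, S, p.
apply/seteqP; split=> // F _; apply: contrapT => nF; apply: WT.
have OF w : O w F by apply: contrapT => nO; apply: nF; exists (~` O w) => //; exists w.
apply/card_leRP; exists (fun w t => exists S p, [/\ ultrafilter_sets F p, decides (lev t) S p & l t S = Some w]).
split=> [w _|w w' t _ _ [S [p [Fp tp lw]]] [S' [p' [Fp' tp' lw']]]].
  by have [t h] := OF w; exists t.
have := decides_uniq tp tp' (uniform_not_small mP (ultrafilter_and Fp Fp')).
by move=> /lloc; rewrite lw lw' => -[].
Qed.

End StateMachine.

(** * Club guessing *)

Section ClubGuessing.
Variables (d : Order.disp_t) (mu : orderType d) (m : nat -> mu).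
Hypothesis mP : block_seq m.
Local Notation kap := (kap m).
Local Open Scope order_scope.

Let mu_min := mu_min (bs_sing mP).

(** This says that the cofinality of [r] exceeds the cardinality of [K]. *)
Definition cofinality_above T (r : mu) (K : set T) :=
  forall X, X `<=` seg r -> X #<= K -> exists2 y, y < r & forall x, X x -> x < y.

Definition is_max_below (E : set mu) (b e : mu) :=
  [/\ E e, e <= b & forall e', E e' -> e' <= b -> e' <= e].

(** Closedness is expressed by largest elements, because club guessing projects points to a club. If
    [r] is not the least element of [mu], then a club in this sense contains that least element. *)
Definition is_club (r : mu) (E : set mu) :=
  [/\ E `<=` seg r, (forall y, y < r -> exists2 e, E e & y < e) &
      (forall b, b < r -> exists e, is_max_below E b e)].

Lemma cofinality_above_lt T (r : mu) (K : set T) y : infinite_set K ->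
  cofinality_above r K -> y < r -> exists2 z, z < r & y < z.
Proof.
move=> /infinite_setN0[k Kk] rK yr; have [||z zr h] := rK [set y].
- by move=> _ ->.
- by apply: (card_le_fun (f := fun=> k)) => // x x' -> ->.
- by exists z => //; exact: h.
Qed.

(** For unboundedness, build a sequence of type omega with a point of every club between consecutive
    terms; its supremum lies in all the clubs. For closedness, the supremum of the common points up
    to [b] is again common. *)
Lemma club_bigcap I T (A : set I) (F : I -> set mu) (r : mu) (K : set T) :
  infinite_set K -> A !=set0 -> A #<= K -> cofinality_above r K ->
  (forall i, A i -> is_club r (F i)) -> is_club r (\bigcap_(i in A) F i).
Proof.
move=> Ki [i0 Ai0] AK rK Fc; split.
- by move=> x /(_ _ Ai0); have [+ _ _] := Fc _ Ai0; apply.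
- move=> y yr.
  have step z : exists z', z < r -> [/\ z < z', z' < r &
      forall i, A i -> exists2 e, F i e & z < e < z'].
    have [zr|] := boolP (z < r); last by exists z.
    have eP i : exists e, A i -> F i e /\ z < e.
      have [Ai|nAi] := pselect (A i); last by exists z.
      by have [_ /(_ _ zr)[e Fe ze] _] := Fc _ Ai; exists e.
    have [e {}eP] := choice eP.
    have [||z' z'r ez'] := rK (e @` A).
    + by move=> _ [i Ai <-]; have [+ _ _] := Fc _ Ai; apply; have [] := eP _ Ai.
    + exact: card_le_trans (card_image_le _ _) AK.
    exists z' => _; split=> //.
      have [_ ze] := eP _ Ai0; apply: lt_trans ze _.
      by apply: ez'; exists i0.
    move=> i Ai; have [Fe ze] := eP _ Ai; exists (e i) => //.
    by rewrite ze ez' //; exists i.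
  have [s sP] := choice step.
  pose t n := iter n s y.
  have tr n : t n < r by elim: n => //= n /sP[].
  have [||b br tb] := rK (range t).
  + by move=> _ [n _ <-]; exact: tr.
  + apply: card_le_trans (card_image_le _ _) _; exact/infiniteP.
  have [z zt zmin] := mu_min (ex_intro (fun z => forall n, t n < z) b
    (fun n => tb _ (imageT t n))).
  have zr : z < r by apply: le_lt_trans br; apply: zmin => n; apply: tb; exists n.
  exists z; last exact: (zt 0).
  move=> i Ai; have [_ _ /(_ _ zr)[e [Fe ez emax]]] := Fc _ Ai.
  suff -> : z = e by [].
  apply/eqP; rewrite eq_le ez andbT; apply: zmin => n.
  have [_ _ /(_ _ Ai)[e' Fe' /andP[te' e't]]] := sP _ (tr n).
  apply: lt_le_trans te' (emax _ Fe' _); apply: ltW; apply: lt_trans e't _.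
  exact: (zt n.+1).
- move=> b br.
  have [s sub smin] := mu_min (ex_intro
    (fun z => forall e, (\bigcap_(i in A) F i) e -> e <= b -> e <= z) b (fun _ _ h => h)).
  have sb : s <= b by apply: smin.
  exists s; split=> // i Ai.
  have [_ _ /(_ _ (le_lt_trans sb br))[e [Fe es emax]]] := Fc _ Ai.
  suff -> : s = e by [].
  apply/eqP; rewrite eq_le es andbT; apply: smin => e' Fe' e'b.
  by apply: emax; [exact: Fe'|exact: sub].
Qed.

Lemma club_seg T (r : mu) (K : set T) : infinite_set K -> cofinality_above r K -> is_club r (seg r).
Proof.
move=> Ki rK; split=> // [y yr|b br].
  by have [z zr yz] := cofinality_above_lt Ki rK yr; exists z.
by exists b; split.
Qed.

Lemma not_cofinal (r : mu) (X : set mu) :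
  ~ (forall y, y < r -> exists2 x, X x & y <= x) ->
  exists2 y, y < r & forall x, X x -> x < y.
Proof.
move=> /existsNP[y /not_implyP[yr h]]; exists y => // x Xx.
by rewrite ltNge; apply/negP => yx; apply: h; exists x.
Qed.

Lemma card_cofinal_cover T (K : set T) (r : mu) (B X : set mu) :
  infinite_set K -> B `<=` seg r -> X #<= K ->
  (forall x, X x -> B `&` seg x #<= K) ->
  (forall y, y < r -> exists2 x, X x & y <= x) -> B #<= K.
Proof.
move=> Ki Br XK BK Xc.
have : B `<=` \bigcup_(x in X) ((B `&` seg x) `|` [set x]).
  move=> y By; have [x Xx] := Xc _ (Br _ By).
  by rewrite le_eqVlt => /orP[/eqP->|yx]; exists x => //; [right|left].
move=> /subset_card_le/card_le_trans; apply; apply: card_le_bigcup => // x Xx.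
apply: card_leU => //; first exact: BK.
have [k Kk] := infinite_setN0 Ki.
by apply: (card_le_fun (f := fun=> k)) => // y y' -> ->.
Qed.

(** Shelah's method: fix ladders [Cs dl] and guess with their projections [cE E dl] to a club [E].
    If for each [E] these guesses fail on a club [D E], iterate the corrections along [w]. The
    projections of one ladder stabilise before [w] and so fall into a correction, which makes them
    too few to be cofinal in [dl]. *)
Lemma club_guess (r : mu) n : cofinality_above r (kap n.+3) ->
  exists c : mu -> set mu, forall E, is_club r E ->
    exists2 dl, c dl `<=` E & ~ (c dl #<= kap n).
Proof.
move=> rK.
have k_inf i : infinite_set (kap i) by exact: kap_infinite.
pose goodC (dl : mu) (C : set mu) := [/\ C `<=` seg dl, (forall y, y < dl -> exists2 e, C e & y <= e) &
  C #<= kap n.+1].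
have [Cs CsP] : exists Cs : mu -> set mu, forall dl, (exists C, goodC dl C) -> goodC dl (Cs dl).
  have h dl : exists C', (exists C, goodC dl C) -> goodC dl C'.
    by have [[C CP]|nC] := pselect (exists C, goodC dl C); [exists C|exists set0].
  by have [f fP] := choice h; exists f.
pose cE (E : set mu) (dl : mu) : set mu := [set e | exists2 b, Cs dl b & is_max_below E b e].
apply: contrapT => ng.
have [D DP] : exists D : set mu -> set mu, forall E, is_club r E -> is_club r (D E) /\
    forall dl, cE E dl `<=` D E -> cE E dl #<= kap n.
  have h (E : set mu) : exists DE, is_club r E -> is_club r DE /\
      forall dl, cE E dl `<=` DE -> cE E dl #<= kap n.
    apply: contrapT => nD; apply: ng; exists (cE E) => D Dc.
    apply: contrapT => nd; apply: nD; exists D => _; split=> // dl sub.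
    by apply: contrapT => big; apply: nd; exists dl.
  by have [f fP] := choice h; exists f.
(* [w] plays the role of the successor cardinal of [kap n.+1]: it has at most [kap n.+2]
   predecessors and, by [w_bd], cofinality above [kap n.+1]. *)
have [w wP wmin] : exists2 w : mu, ~ (seg w #<= kap n.+1) & forall w' : mu, ~ (seg w' #<= kap n.+1) -> w <= w'.
  by apply: mu_min; exists (m n.+2); exact: kap_lt.
have wlt a : a < w -> seg a #<= kap n.+1.
  by move=> aw; apply: contrapT => /wmin; rewrite leNgt aw.
have wle : seg w #<= kap n.+2.
  apply: (card_le_initial (A := kap _) (mu_wo (bs_sing mP)) (k_inf _) (kap_lt mP (ltnSn n.+1))) => x xw.
  by apply: card_le_trans (wlt _ xw); apply: subset_card_le => y [].
(* Decreasing clubs, each contained in the corrections of all earlier ones. *)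
have [|||Es EsP] := @wf_rec mu (set mu) (fun x y => x < y) set0
    (fun a h y => y = [set x | x < r /\ forall b, b < a -> D (h b) x]).
- by have [] := mu_wo (bs_sing mP).
- move=> a h h' y hh' ->; apply/seteqP; split=> x [xr xD]; split=> // b ba.
    by rewrite -hh' //; exact: xD.
  by rewrite hh' //; exact: xD.
- by move=> a h _; eexists.
have Ec a : a <= w -> is_club r (Es a).
  have [wf _ _] := mu_wo (bs_sing mP).
  elim/(well_founded_ind wf): a => a IH aw.
  pose F (i : option mu) := if i is Some b then D (Es b) else seg r.
  pose A := [set None] `|` (some @` seg a).
  have -> : Es a = \bigcap_(i in A) F i.
    rewrite EsP; apply/seteqP; split=> [x [xr xD] _ [->|[b ba <-]]|x xA]; first by [].
      exact: xD.
    by split=> [|b ba]; [apply: (xA None); left|apply: (xA (Some b)); right; exists b].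
  apply: (club_bigcap (k_inf n.+3)) => //.
  - by exists None; left.
  - apply: card_leU; first exact: k_inf.
      have [k Kk] := infinite_setN0 (k_inf n.+3).
      by apply: (card_le_fun (f := fun=> k)) => // x x' -> ->.
    apply: card_le_trans (card_image_le _ _) _.
    apply: card_le_trans (seg_le aw) _; apply: card_le_trans wle (kap_le mP _).
    by rewrite leqnSn.
  - move=> _ [->|[b ba <-]]; first exact: club_seg (k_inf _) rK.
    by have [] := DP _ (IH _ ba (ltW (lt_le_trans ba aw))).
have Esub a a' : a <= a' -> Es a' `<=` Es a.
  move=> aa'; rewrite (EsP a) (EsP a') => x [xr xD]; split=> // b ba; apply: xD.
  exact: lt_le_trans ba aa'.
have [Ew_r Ew_unb _] := Ec w (lexx w).
have [dl dlP dlmin] : exists2 dl, ~ (Es w `&` seg dl #<= kap n) &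
    forall x, ~ (Es w `&` seg x #<= kap n) -> dl <= x.
  apply: mu_min; exists r => h.
  have [||y yr yb] := rK (Es w) => //.
    have -> : Es w = Es w `&` seg r by apply/esym/setIidPl.
    by apply: card_le_trans h (kap_le mP _); rewrite -addn3 leq_addr.
  have [e Ee ye] := Ew_unb _ yr.
  by have := lt_trans ye (yb _ Ee); rewrite ltxx.
have dllt x : x < dl -> Es w `&` seg x #<= kap n.
  by move=> xd; apply: contrapT => /dlmin; rewrite leNgt xd.
have dlr : dl < r.
  rewrite ltNge; apply/negP => rdl.
  have Ele : Es w #<= kap n.+1.
    apply: (card_le_initial (A := kap _) (mu_wo (bs_sing mP)) (k_inf _) (kap_lt mP (ltnSn n))) => x Ex.
    by apply: dllt; apply: lt_le_trans rdl; exact: Ew_r.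
  have [||y yr yb] := rK (Es w) => //.
    by apply: card_le_trans Ele (kap_le mP _); rewrite -addn3 -addn1 leq_add2l.
  have [e Ee ye] := Ew_unb _ yr.
  by have := lt_trans ye (yb _ Ee); rewrite ltxx.
have dl_cof X : X `<=` seg dl -> X #<= kap n -> ~ (forall y, y < dl -> exists2 x, X x & y <= x).
  move=> Xd Xn Xc; apply: dlP.
  apply: (card_cofinal_cover (k_inf n) (r := dl) _ Xn _ Xc); first by move=> x [].
  move=> x Xx; apply: card_le_trans (dllt _ (Xd _ Xx)).
  by apply: subset_card_le => y [[]].
have [Cd Cc Cn] : goodC dl (Cs dl).
  apply: CsP; exists (Es w `&` seg dl); split.
  - by move=> x [].
  - move=> y yd; apply: contrapT => h; apply: dlP; apply: card_le_trans (dllt _ yd).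
    apply: subset_card_le => x [Ex xd]; split=> //; rewrite /seg /= ltNge.
    by apply/negP => yx; apply: h; exists x.
  - apply: (card_le_initial (A := kap _) (mu_wo (bs_sing mP)) (k_inf _) (kap_lt mP (ltnSn n))) => x [Ex xd].
    by apply: card_le_trans (dllt _ xd); apply: subset_card_le => y [[]].
(* The maximum of Es a below b can only decrease with a, hence is eventually constant. *)
have [st stP] : exists st : mu -> mu, forall b, Cs dl b -> st b < w /\
    forall a e e', a < w -> is_max_below (Es (st b)) b e -> is_max_below (Es a) b e' -> e <= e'.
  have h b : exists s, Cs dl b -> s < w /\
      forall a e e', a < w -> is_max_below (Es s) b e -> is_max_below (Es a) b e' -> e <= e'.
    have [Cb|nCb] := pselect (Cs dl b); last by exists w.
    have br : b < r by apply: lt_trans dlr; exact: Cd.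
    have [x xw] : exists x, x < w.
      apply: contrapT => h; apply: wP; apply: card_le_trans (nat_kap mP _).
      have -> : seg w = set0 by apply/seteqP; split=> // x xw; apply: h; exists x.
      exact: card_ge0.
    have [_ _ /(_ _ br)[e0 e0P]] := Ec _ (ltW xw).
    have [e [a [aw ae]] emin] := mu_min (ex_intro
      (fun e => exists a, a < w /\ is_max_below (Es a) b e) e0 (ex_intro _ x (conj xw e0P))).
    exists a => _; split=> // a' e1 e2 a'w [E1 e1b e1m] ae2.
    have := emin e2 (ex_intro _ a' (conj a'w ae2)); apply: le_trans.
    by case: ae => Ee eb em; exact: em.
  by have [f fP] := choice h; exists f.
have w_bd (X : set mu) : X #<= kap n.+1 -> (forall x, X x -> x < w) ->
    exists2 y, y < w & forall x, X x -> x < y.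
  move=> Xn Xw; apply: not_cofinal => Xc; apply: wP.
  apply: (card_cofinal_cover (k_inf n.+1) (r := w) _ Xn _ Xc) => // x Xx.
  by apply: card_le_trans (wlt _ (Xw _ Xx)); apply: subset_card_le => y [].
have [a aw ast] := w_bd (st @` Cs dl) (card_le_trans (card_image_le _ _) Cn)
  ltac:(by move=> _ [b Cb <-]; have [] := stP _ Cb).
have [a' a'w aa'] : exists2 a', a' < w & a < a'.
  have [||a' a'w h] := w_bd [set a].
  - have [k Kk] := infinite_setN0 (k_inf n.+1).
    by apply: (card_le_fun (f := fun=> k)) => // x x' -> ->.
  - by move=> _ ->.
  - by exists a' => //; exact: h.
have ac := Ec _ (ltW aw).
(* The projections no longer change between [a] and [a'], so they belong to [Es a'] and hence to the
   correction of [Es a]. *)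
have sub : cE (Es a) dl `<=` D (Es a).
  move=> e [b Cb ae].
  have br : b < r by apply: lt_trans dlr; exact: Cd.
  have [_ _ /(_ _ br)[e' a'e']] := Ec _ (ltW a'w).
  have [_ _ /(_ _ br)[e0 se0]] := Ec _ (ltW (stP _ Cb).1).
  suff -> : e = e'.
    by case: a'e' => + _ _; rewrite EsP => -[_]; exact.
  apply/eqP; rewrite eq_le; apply/andP; split.
    apply: (le_trans (y := e0)).
      case: ae se0 => Ee eb em [E0 e0b e0m]; apply: e0m => //.
      by apply: Esub Ee; apply: ltW; apply: ast; exists b.
    exact: (stP _ Cb).2 a'w se0 a'e'.
  case: ae a'e' => Ee eb em [E' e'b e'm]; apply: em => //.
  exact: Esub (ltW aa') _ E'.
have cEn := (DP _ ac).2 dl sub.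
apply: (dl_cof (cE (Es a) dl)) cEn _.
  by move=> e [b /Cd bd [_ eb _]]; exact: le_lt_trans eb bd.
(* The projections are cofinal: some point of [Es w] at or above [y] lies below a ladder point [b],
   hence not above the projection of [b]. *)
move=> y yd.
have [e0 [Ee0 e0d] ye0] : exists2 e, (Es w `&` seg dl) e & y <= e.
  apply: contrapT => h; apply: dlP; apply: card_le_trans (dllt _ yd).
  apply: subset_card_le => x [Ex xd]; split=> //; rewrite /seg /= ltNge.
  by apply/negP => yx; apply: h; exists x.
have [b Cb e0b] := Cc _ e0d.
have br : b < r by apply: lt_trans dlr; exact: Cd.
have [_ _ /(_ _ br)[e ae]] := ac.
exists e; first by exists b.
by apply: le_trans ye0 _; case: ae => _ _; apply => //; exact: Esub (ltW aw) _ Ee0.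
Qed.

End ClubGuessing.

(** * Slot systems *)

Section SlotSystems.
Variables (d : Order.disp_t) (mu : orderType d) (m : nat -> mu).
Hypothesis mP : block_seq m.
Local Notation kap := (kap m).
Local Notation small := (small m).
Local Open Scope order_scope.

Let mu_min := mu_min (bs_sing mP).

Definition slot (a b : mu) : set mu := [set x | a <= x < b].

(* A function f : nat -> mu chooses the slot [ss_lo f k, ss_hi f k) in each block k of ss_dom. *)
Record slot_system := SlotSystem {
  ss_dom : set nat;
  ss_lo : (nat -> mu) -> nat -> mu;
  ss_hi : (nat -> mu) -> nat -> mu }.

Record slot_system_axioms (Z : slot_system) : Prop := SlotSystemAxioms {
  ss_unb : forall N, exists2 k, (N <= k)%N & ss_dom Z k;
  ss_lt : forall f k, ss_dom Z k -> ss_lo Z f k < ss_hi Z f k;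
  ss_disj : forall f f' k, ss_dom Z k ->
    [\/ ss_lo Z f k = ss_lo Z f' k /\ ss_hi Z f k = ss_hi Z f' k,
        ss_hi Z f k <= ss_lo Z f' k | ss_hi Z f' k <= ss_lo Z f k];
  ss_ev : forall f f', f <> f' -> exists N, forall k, (N <= k)%N -> ss_dom Z k ->
    ss_hi Z f k <= ss_lo Z f' k \/ ss_hi Z f' k <= ss_lo Z f k }.

Definition slots_meet (q : set mu) (Z : slot_system) := forall N, exists K,
  forall k f, (K <= k)%N -> ss_dom Z k ->
    ~ (q `&` blk m k `&` slot (ss_lo Z f k) (ss_hi Z f k) #<= kap N).

(** Let [r] be least such that the block of [q] has more than [kap n.+3] points below [r]; then [r]
    has large cofinality. The points [e] such that every slot ending at [e] holds many points of [q]
    form a club in [r], and a guessing set inside this club is as required. *)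
Lemma block_guess : exists g : mu -> nat -> mu -> set mu, forall q k n,
  ~ (q `&` blk m k #<= kap n.+3) -> exists r dl, ~ (g r n dl #<= kap n) /\
    forall e e', g r n dl e -> g r n dl e' -> e < e' ->
      ~ (q `&` blk m k `&` slot e e' #<= kap n).
Proof.
have k_inf i : infinite_set (kap i) by exact: kap_infinite.
have [g gP] : exists g : mu * nat -> mu -> set mu, forall rn,
    cofinality_above rn.1 (kap rn.2.+3) -> forall E, is_club rn.1 E ->
    exists2 dl, g rn dl `<=` E & ~ (g rn dl #<= kap rn.2).
  have h (rn : mu * nat) : exists c : mu -> set mu, cofinality_above rn.1 (kap rn.2.+3) ->
    forall E, is_club rn.1 E -> exists2 dl, c dl `<=` E & ~ (c dl #<= kap rn.2).
    have [/(club_guess mP)[c cP]|nc] := pselect (cofinality_above rn.1 (kap rn.2.+3)).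
      by exists c.
    by exists (fun=> set0).
  by have [f fP] := choice h; exists f.
exists (fun r n => g (r, n)) => q k n qk.
set Q := q `&` blk m k in qk *.
have [r rP rmin] : exists2 r : mu, ~ (Q `&` seg r #<= kap n.+3) &
    forall r' : mu, ~ (Q `&` seg r' #<= kap n.+3) -> r <= r'.
  apply: mu_min; exists (m k) => h; apply: qk; apply: card_le_trans h.
  by apply: subset_card_le => x Qx; split=> //; have [] := Qx.2.
have rlt x : x < r -> Q `&` seg x #<= kap n.+3.
  by move=> xr; apply: contrapT => /rmin; rewrite leNgt xr.
have rK : cofinality_above r (kap n.+3).
  move=> X Xr XK; apply: not_cofinal => Xc; apply: rP.
  apply: (card_cofinal_cover (k_inf _) (r := r) _ XK _ Xc); first by move=> x [].
  move=> x Xx; apply: card_le_trans (rlt _ (Xr _ Xx)).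
  by apply: subset_card_le => y [[]].
have big y : y < r -> exists2 z, z < r & ~ (Q `&` slot y z #<= kap n).
  move=> yr; apply: contrapT => h; apply: rP.
  have h' : Q `&` slot y r #<= kap n.+1.
    apply: (card_le_initial (A := kap n) (mu_wo (bs_sing mP)) (k_inf _) (kap_lt mP (ltnSn n))).
    move=> x [Qx /andP[yx xr]]; apply: contrapT => hx; apply: h; exists x => //.
    apply: contra_not hx; apply: card_le_trans; apply: subset_card_le.
    by move=> z [[Qz /andP[yz _]] zx]; split=> //; rewrite /slot /= yz.
  have : Q `&` seg r `<=` (Q `&` seg y) `|` (Q `&` slot y r).
    move=> x [Qx xr]; case: (ltP x y) => xy; [left|right] => //.
    by split=> //; rewrite /slot /= xy.
  move=> /subset_card_le/card_le_trans; apply; apply: card_leU => //.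
    exact: rlt.
  by apply: card_le_trans h' (kap_le mP _); rewrite -addn3 -addn1 leq_add2l.
have [bot _ botP] := mu_min (ex_intro setT r I).
(* [bot] is added for the sake of [is_club]; it is never the right end of a slot. *)
pose E : set mu := [set e | e < r /\ (e = bot \/ forall y, y < e -> ~ (Q `&` slot y e #<= kap n))].
have Ec : is_club r E.
  split.
  - by move=> e [].
  - move=> y yr.
    have step z : exists z', z < r -> [/\ z < z', z' < r & ~ (Q `&` slot z z' #<= kap n)].
      have [zr|] := boolP (z < r); last by exists z.
      have [z' z'r zz'] := big _ zr; exists z' => _; split=> //.
      rewrite ltNge; apply/negP => z'z; apply: zz'.
      apply: card_le_trans (subset_card_le (B := set0) _) (card_ge0 _ _).
      move=> x [_ /andP[zx xz']].
      by have := lt_le_trans (le_lt_trans zx xz') z'z; rewrite ltxx.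
    have [s sP] := choice step.
    pose t i := iter i s y.
    have tr i : t i < r by elim: i => //= i /sP[].
    have [||b br tb] := rK (range t).
    + by move=> _ [i _ <-]; exact: tr.
    + by apply: card_le_trans (card_image_le _ _) _; exact/infiniteP.
    have [z zt zmin] := mu_min (ex_intro (fun z => forall i, t i < z) b
      (fun i => tb _ (imageT t i))).
    have zr : z < r by apply: le_lt_trans br; apply: zmin => i; apply: tb; exists i.
    exists z; last exact: (zt 0).
    split=> //; right => x xz.
    have [i xi] : exists i, x <= t i.
      apply: contrapT => h; have : z <= x.
        by apply: zmin => i; rewrite ltNge; apply/negP => xi; apply: h; exists i.
      by rewrite leNgt xz.
    have [_ _] := sP _ (tr i); apply: contra_not; apply: card_le_trans.
    apply: subset_card_le => u [Qu /andP[iu uz]]; split=> //; rewrite /slot /= (le_trans xi iu) /=.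
    exact: lt_trans uz (zt i.+1).
  - move=> b br.
    have [s sub smin] := mu_min (ex_intro (fun z => forall e, E e -> e <= b -> e <= z) b (fun _ _ h => h)).
    have sb : s <= b by apply: smin.
    exists s; split=> //; split; first exact: le_lt_trans sb br.
    have [->|/eqP sbot] := pselect (s = bot); first by left.
    right=> y ys.
    have [e [Ee eb ye]] : exists e, [/\ E e, e <= b & y < e].
      apply: contrapT => h; have : s <= y.
        apply: smin => e Ee eb; rewrite leNgt; apply/negP => ye; apply: h.
        by exists e.
      by rewrite leNgt ys.
    case: Ee (sub _ Ee eb) => er [e0|he] es.
      by move: ye; rewrite e0 ltNge botP.
    apply: contra_not (he _ ye); apply: card_le_trans; apply: subset_card_le.
    by move=> x [Qx /andP[yx xe]]; split=> //; rewrite /slot /= yx (lt_le_trans xe).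
have [dl dlE dln] := gP (r, n) rK E Ec.
exists r, dl; split=> // e e' /dlE[_ _] /dlE[_ [->|h]] ee'; last exact: h.
by move: ee'; rewrite ltNge botP.
Qed.

Lemma nodes_card (bot : mu) n l : bot < m n ->
  [set g : nat -> mu | (forall i, (l <= i)%N -> g i = bot) /\ forall i, g i < m n] #<= kap n.
Proof.
move=> botm; elim: l => [|l IH].
  apply: (card_le_fun (f := fun=> bot)) => // g g' [g0 _] [g0' _] _.
  by apply: functional_extensionality_dep => i; rewrite g0 ?g0'.
apply: card_le_trans (card_square (@kap_infinite _ _ _ mP n)).
apply: card_le_trans (card_leX (card_lexx (kap n)) IH).
apply: (card_le_fun (f := fun g => (g l, fun i => if i == l then bot else g i))).
  move=> g [g0 gm]; split; first exact: gm.
  split=> [i|i] /=; last by case: (i == l).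
  rewrite leq_eqVlt => /orP[/eqP <-|li]; first by rewrite eqxx.
  by rewrite (g0 _ li); case: (i == l).
move=> g g' _ _ e; apply: functional_extensionality_dep => i.
have [-> //|/negbTE il] := eqVneq i l; first exact: (congr1 fst e).
by have /= := congr1 (fun p : mu * (nat -> mu) => p.2 i) e; rewrite il.
Qed.

(** A name [j] codes one guessing set per block, so there are only mu^omega systems. For a large
    [q], choose blocks [K n] and guessing sets with more than [kap n] points. The first [n] values
    of [f], cut off at [m n], select a slot between consecutive points of the [n]-th set; distinct
    functions eventually select disjoint slots. *)
Lemma slot_systems_exist : exists Z : (nat -> mu) -> slot_system, forall q, ~ small q ->
  exists2 j, slot_system_axioms (Z j) & slots_meet q (Z j).
Proof.
have [g gP] := block_guess.
have [bot _ botP] := mu_min (ex_intro setT (m 0) I).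
have k_inf i : infinite_set (kap i) by exact: kap_infinite.
have mu_inf : infinite_set [set: mu].
  by apply: card_le_infinite (card_leT _) (k_inf 0).
have [i [_ iI]] : exists i : mu * nat * mu -> mu, (forall x, [set: mu] (i x)) /\ injective i.
  apply: card_le_funT; apply: card_le_trans (card_leX_inf mu_inf (A := setT) (B := setT) _ (card_lexx _)).
    by apply: subset_card_le.
  apply: card_le_trans (card_leX_inf mu_inf (A := setT) (B := setT) (card_lexx _) _).
    by apply: subset_card_le.
  exact/infiniteP.
(* A zero in the middle of a code stands for the empty guessing set; a successor [n'.+1] stands for
   the index [n']. *)
have [C CP] : exists C : mu -> set mu, forall r n dl,
    C (i (r, n, dl)) = if n is n'.+1 then g r n' dl else set0.
  exists (fun x => if pselect (exists p, i p = x) is left h then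
    let p := sval (cid h) in if p.1.2 is n'.+1 then g p.1.1 n' p.2 else set0 else set0).
  move=> r n dl; case: pselect => [h|[]]; last by exists (r, n, dl).
  by case: cid => p /= /iI ->.
pose made (j : nat -> mu) (Z : slot_system) := slot_system_axioms Z /\
  forall k f, ss_dom Z k -> C (j k) (ss_lo Z f k) /\ C (j k) (ss_hi Z f k).
have [Z ZP] : exists Z : (nat -> mu) -> slot_system, forall j, (exists Z, made j Z) -> made j (Z j).
  have h (j : nat -> mu) : exists Z, (exists Z, made j Z) -> made j Z.
    have [[Y YP]|nY] := pselect (exists Z, made j Z); first by exists Y.
    by exists (SlotSystem set0 (fun _ _ => bot) (fun _ _ => bot)).
  by have [f fP] := choice h; exists f.
exists Z => q ql.
have step N : exists k, (N <= k)%N /\ ~ (q `&` blk m k #<= kap N).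
  by have [k Nk hk] := large_blk mP N ql; exists k.
have [s sP] := choice step.
pose K := fix K n := if n is n'.+1 then s (maxn n.+3 (K n').+1) else s 3.
have KS n : (K n < K n.+1)%N.
  by have [h _] := sP (maxn n.+4 (K n).+1); apply: leq_trans h; rewrite leq_maxr.
have Kmono : {mono K : x y / (x <= y)%N}.
  by apply: leq_mono; apply: homo_ltn => // ? ? ?; exact: ltn_trans.
have KI : injective K by exact: (incn_inj Kmono).
have Kbig n : ~ (q `&` blk m (K n) #<= kap n.+3).
  case: n => [|n]; first by have [] := sP 3.
  have [_] := sP (maxn n.+4 (K n).+1); apply: contra_not => h.
  by apply: card_le_trans h (kap_le mP _); rewrite leq_maxl.
have [rd rdP] : exists rd : nat -> mu * mu, forall n, ~ (g (rd n).1 n (rd n).2 #<= kap n) /\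
    forall e e', g (rd n).1 n (rd n).2 e -> g (rd n).1 n (rd n).2 e' -> e < e' ->
      ~ (q `&` blk m (K n) `&` slot e e' #<= kap n).
  have h n : exists p : mu * mu, ~ (g p.1 n p.2 #<= kap n) /\
    forall e e', g p.1 n p.2 e -> g p.1 n p.2 e' -> e < e' ->
      ~ (q `&` blk m (K n) `&` slot e e' #<= kap n).
    by have [r [dl h]] := gP _ _ _ (Kbig n); exists (r, dl).
  by have [f fP] := choice h; exists f.
pose j k := if pselect (exists n, K n = k) is left h then
  let n := sval (cid h) in i ((rd n).1, n.+1, (rd n).2) else i (bot, 0, bot).
have jK n : C (j (K n)) = g (rd n).1 n (rd n).2.
  rewrite /j; case: pselect => [h|[]]; last by exists n.
  by case: cid => n' /= /KI ->; rewrite CP.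
have j0 k : ~ (exists n, K n = k) -> C (j k) = set0.
  by move=> h; rewrite /j; case: pselect => // ?; rewrite CP.
suff ex : exists Z, made j Z.
  have [Zax Zc] := ZP _ ex; exists j => // N; exists (K N) => k f Nk Ak.
  have [clo chi] := Zc _ f Ak.
  have [[n nk]|/j0 e] := pselect (exists n, K n = k); last by move: clo; rewrite e.
  move: clo chi Nk (ss_lt Zax f Ak); rewrite -nk jK Kmono => clo chi Nn lohi.
  have [_ /(_ _ _ clo chi lohi)] := rdP n; apply: contra_not => h.
  exact: card_le_trans h (kap_le mP Nn).
pose c n : set mu := g (rd n).1 n (rd n).2.
(* A possible last point of [c n] is dropped, so that every point of [c' n] has a successor [nx] in
   [c n]. *)
pose c' n : set mu := [set e | c n e /\ exists2 e', c n e' & e < e'].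
have [nx nxP] : exists nx : nat -> mu -> mu, forall n e, c' n e ->
    [/\ c n (nx n e), e < nx n e & forall e', c n e' -> e < e' -> nx n e <= e'].
  have h (p : nat * mu) : exists y, c' p.1 p.2 ->
    [/\ c p.1 y, p.2 < y & forall e', c p.1 e' -> p.2 < e' -> y <= e'].
    have [[cp [e' ce' pe']]|nc] := pselect (c' p.1 p.2); last by exists bot.
    have [y [cy py] ymin] := mu_min (ex_intro (fun y => c p.1 y /\ p.2 < y) e' (conj ce' pe')).
    by exists y => _; split=> // u cu pu; exact: ymin.
  by have [f fP] := choice h; exists (fun n e => f (n, e)) => n e; exact: (fP (n, e)).
have c'big n : kap n #<= c' n.
  apply: card_leNgt => h; have [big _] := rdP n; apply: big.
  have [k Kk] := infinite_setN0 (k_inf n).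
  have [[e [ce emax]]|nmax] := pselect (exists e, c n e /\ forall e', c n e' -> e' <= e).
    have : c n `<=` c' n `|` [set e].
      move=> x cx; have := emax _ cx; rewrite le_eqVlt => /orP[/eqP ->|xe]; first by right.
      by left; split=> //; exists e.
    move=> /subset_card_le/card_le_trans; apply; apply: card_leU => //.
    by apply: (card_le_fun (f := fun=> k)) => // x x' -> ->.
  apply: card_le_trans h; apply: subset_card_le => x cx; split=> //.
  apply: contrapT => nx'; apply: nmax; exists x; split=> // e' ce'.
  by rewrite leNgt; apply/negP => xe'; apply: nx'; exists e'.
have botm n : bot < m n.
  have [x xk] := infinite_setN0 (k_inf n); exact: le_lt_trans (botP x I) xk.
pose nod n : set (nat -> mu) :=
  [set g | (forall i, (n <= i)%N -> g i = bot) /\ forall i, g i < m n].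
have [R [RP RI]] : exists R : nat -> (nat -> mu) -> mu, (forall n f, nod n f -> c' n (R n f)) /\
    forall n f f', nod n f -> nod n f' -> R n f = R n f' -> f = f'.
  have h n : exists R : (nat -> mu) -> mu, (forall f, nod n f -> c' n (R f)) /\
      forall f f', nod n f -> nod n f' -> R f = R f' -> f = f'.
    have /card_leRP[Q [tQ iQ]] := card_le_trans (nodes_card n (botm n)) (c'big n).
    have h' f : exists y, nod n f -> c' n y /\ Q f y.
      have [nf|nnf] := pselect (nod n f); last by exists bot.
      by have [y cy fy] := tQ _ nf; exists y.
    have [r rP] := choice h'; exists r; split=> [f /rP[]//|f f' nf nf' e].
    apply: (iQ _ _ (r f)) => //; first by have [] := rP _ nf.
    by rewrite e; have [] := rP _ nf'.
  have [R {}RP] := choice h.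
  by exists R; split=> n; [have [+ _] := RP n|have [_ +] := RP n].
pose tr n (f : nat -> mu) i := if (i < n)%N && (f i < m n) then f i else bot.
have trn n f : nod n (tr n f).
  split=> l; rewrite /tr; first by rewrite leqNgt => /negbTE ->.
  by case: ifP => // /andP[].
pose rk k := if pselect (exists n, K n = k) is left h then sval (cid h) else 0.
have rkK n : rk (K n) = n.
  rewrite /rk; case: pselect => [h|[]]; last by exists n.
  by case: cid => n' /= /KI.
pose lo f k := R (rk k) (tr (rk k) f).
pose hi f k := nx (rk k) (lo f k).
have loc n f : c' n (lo f (K n)) by rewrite /lo rkK; exact: RP.
have hiP n f : [/\ c n (hi f (K n)), lo f (K n) < hi f (K n) &
    forall e', c n e' -> lo f (K n) < e' -> hi f (K n) <= e'].
  by rewrite /hi rkK; apply: nxP; exact: loc.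
have dich n f f' : [\/ lo f (K n) = lo f' (K n) /\ hi f (K n) = hi f' (K n),
        hi f (K n) <= lo f' (K n) | hi f' (K n) <= lo f (K n)].
  have [[cl _] [cl' _]] := (loc n f, loc n f').
  have [[_ _ h] [_ _ h']] := (hiP n f, hiP n f').
  case: (ltgtP (lo f (K n)) (lo f' (K n))) => e.
  - by apply: Or32; exact: h.
  - by apply: Or33; exact: h'.
  - by apply: Or31; split=> //; rewrite /hi e.
exists (SlotSystem (range K) lo hi); split; last first.
  by move=> _ f [n _ <-] /=; rewrite jK; split; [have [] := loc n f|have [] := hiP n f].
split=> /=.
- move=> N; exists (K N); last by exists N.
  by elim: N => // N IH; exact: leq_ltn_trans IH (KS N).
- by move=> f _ [n _ <-]; have [] := hiP n f.
- by move=> f f' _ [n _ <-].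
- move=> f f' ff'.
  have [l fl] : exists l, f l <> f' l.
    apply: contrapT => h; apply: ff'; apply: functional_extensionality_dep => l.
    by apply: contrapT => hl; apply: h; exists l.
  have [[n1 n1P] [n2 n2P]] := (bs_ex mP (f l), bs_ex mP (f' l)).
  pose N := maxn l.+1 (maxn n1 n2).
  exists (K N) => k Nk [n _ nk]; move: Nk; rewrite -{}nk Kmono => Nn.
  case: (dich n f f') => [[e _]|h|h]; [|by left|by right].
  exfalso; apply: fl; move: e; rewrite /lo rkK => /(RI _ _ _ (trn _ _) (trn _ _)).
  move=> /(congr1 (fun u => u l)); rewrite /tr.
  have -> : (l < n)%N by apply: leq_trans Nn; rewrite leq_maxl.
  have -> : f l < m n.
    by apply: lt_le_trans n1P (m_le mP _); apply: leq_trans Nn; rewrite !leq_max leqnn orbT.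
  have -> // : f' l < m n.
  by apply: lt_le_trans n2P (m_le mP _); apply: leq_trans Nn; rewrite !leq_max leqnn !orbT.
Qed.

End SlotSystems.

(** * Sets of natural numbers modulo finite sets *)

Definition almost (A : set nat) (P : nat -> Prop) :=
  exists N, forall k, (N <= k)%N -> A k -> P k.

Definition unbounded (A : set nat) := forall N, exists2 k, (N <= k)%N & A k.

Lemma not_almost A P : ~ almost A P -> unbounded (A `&` [set k | ~ P k]).
Proof.
move=> h N; apply: contrapT => n; apply: h; exists N => k Nk Ak.
by apply: contrapT => nP; apply: n; exists k.
Qed.

Lemma almostI A P Q : almost A P -> almost A Q -> almost A (fun k => P k /\ Q k).
Proof.
move=> [N h] [N' h']; exists (maxn N N') => k; rewrite geq_max => /andP[Nk N'k] Ak.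
by split; [exact: h|exact: h'].
Qed.

Lemma almost_sub A B P : almost A B -> almost B P -> almost A P.
Proof.
move=> [N h] [N' h']; exists (maxn N N') => k; rewrite geq_max => /andP[Nk N'k] Ak.
by apply: h' => //; exact: h.
Qed.

Lemma unbounded_almost A P : unbounded A -> almost A P -> unbounded (A `&` [set k | P k]).
Proof.
move=> Au [N h] M; have [k] := Au (maxn M N); rewrite geq_max => /andP[Mk Nk] Ak.
by exists k => //; split=> //; exact: h.
Qed.

Lemma unbounded_pseudo_intersection (f : nat -> set nat) :
  (forall n, unbounded (f n)) -> (forall i n, (i <= n)%N -> almost (f n) (f i)) ->
  exists2 A, unbounded A & forall n, almost A (f n).
Proof.
move=> fu fd.
have Q n j : (j <= n)%N -> almost (f n) (fun k => forall i, (i <= j)%N -> f i k).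
  elim: j => [|j IH] jn.
    have [N h] := fd 0 n jn; exists N => k Nk fk i; rewrite leqn0 => /eqP ->; exact: h.
  have [N h] := almostI (IH (ltnW jn)) (fd _ _ jn); exists N => k Nk fk i.
  have [h1 h2] := h k Nk fk.
  by rewrite leq_eqVlt => /orP[/eqP -> //|]; rewrite ltnS; exact: h1.
have K n : exists k, (n <= k)%N /\ forall i, (i <= n)%N -> f i k.
  by have [k nk [_ h]] := unbounded_almost (fu n) (Q n n (leqnn n)) n; exists k.
have [k kP] := choice K.
exists (range k) => [N|i]; first by exists (k N); [have [] := kP N|exists N].
exists (\max_(n < i) (k n).+1) => k' h [n _ kn]; rewrite -kn in h *.
case: (ltnP n i) => [ni|ni]; last by have [_] := kP n; apply.
have : (k n < k n)%N by exact: leq_trans (leq_bigmax (Ordinal ni)) h.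
by rewrite ltnn.
Qed.

(** * The case 2^omega < mu *)

Section SmallContinuum.
Variables (d : Order.disp_t) (mu : orderType d) (m : nat -> mu).
Hypothesis mP : block_seq m.
Local Notation U := (uniform_ultrafilters mu).
Local Notation small := (small m).
Local Open Scope order_scope.
Variables (Om : Type) (lt : Om -> Om -> Prop).
Hypothesis omP : omega1_order lt.
Variable W : Type.
Hypothesis W_Om : ~ ([set: W] #<= [set: Om]).
Hypothesis Fn_W : ~ ([set: nat -> mu] #<= [set: W]).
Hypothesis Fn_cont : ~ ([set: nat -> mu] #<= [set: set nat]).

Local Notation Fn := (nat -> mu).
Local Notation Int := (nat -> mu * mu).
Local Notation Idx := (Fn * (set nat * W))%type.

Variable Z : Fn -> slot_system mu.
Variable ltF : Fn -> Fn -> Prop.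
Hypothesis ltF_wo : is_wo ltF.
Hypothesis ltF_init : forall j, ~ ([set: Fn] #<= [set x | ltF x j]).
Variable ltX : set nat * W -> set nat * W -> Prop.
Hypothesis ltX_wo : is_wo ltX.

Local Notation ltI := (lexi ltF ltX).

(** Every triple that precedes one with system [j] lies here, and there are fewer than mu^omega such
    triples by [Fn_below]. *)
Definition below (j : Fn) : set Idx := [set z | ltF z.1 j \/ z.1 = j].

Lemma Om_W : [set: Om] #<= [set: W].
Proof. exact: card_leNgt W_Om. Qed.

Lemma Om_infinite : infinite_set [set: Om].
Proof. by move=> /finite_set_countable; exact: o1_uncountable omP. Qed.

Lemma W_below j : [set: W] #<= below j.
Proof.
apply: (card_le_fun (f := fun w => (j, (set0, w)))) => [w _|w w' _ _ [//]].
by right.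
Qed.

Lemma below_infinite j : infinite_set (below j).
Proof. exact: card_le_infinite (card_le_trans Om_W (W_below j)) Om_infinite. Qed.

Lemma cont_below j : [set: set nat] #<= below j.
Proof.
have [w _] := infinite_setN0 (card_le_infinite Om_W Om_infinite).
apply: (card_le_fun (f := fun A => (j, (A, w)))) => [A _|A A' _ _ [//]].
by right.
Qed.

Lemma Fn_below j : ~ ([set: Fn] #<= below j).
Proof.
have Wi := card_le_infinite Om_W Om_infinite; have [w _] := infinite_setN0 Wi.
have -> : below j = [set j' | ltF j' j \/ j' = j] `*` [set: set nat * W].
  by apply/seteqP; split=> // z [].
have Xi : infinite_set [set: set nat * W].
  apply: card_le_infinite Wi; apply: (card_le_fun (f := fun w => (set0, w))) => //.
  by move=> ? ? _ _ [].
apply: (initial_prod ltF_init Xi).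
have -> : [set: set nat * W] = [set: set nat] `*` [set: W] by apply/seteqP; split.
case: (card_le_total [set: set nat] [set: W]) => h.
  apply: contra_not Fn_W => /card_le_trans; apply.
  exact: card_leX_inf Wi h (card_lexx _).
apply: contra_not Fn_cont => /card_le_trans; apply.
exact: card_leX_inf (card_le_infinite h Wi) (card_lexx _) h.
Qed.

Definition iset (I : Int) : set mu :=
  [set x | exists2 k, blk m k x & slot (I k).1 (I k).2 x].

(** The strict inequality makes right endpoints decrease along a path, which [no_slot_path] turns
    into a contradiction. *)
Definition fits a (S : Om -> Int) (x y : mu) k :=
  forall c, lt c a -> (S c k).2 <= x \/ y < (S c k).2.

Definition alive a (S : Om -> Int) (j f : Fn) (A : set nat) :=
  forall c, lt c a -> almost A (fun k => (S c k).1 <= ss_lo (Z j) f k /\ ss_hi (Z j) f k <= (S c k).2).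

(** The first case covers empty intervals, such as the default [(bot, bot)]. *)
Definition sep (I : mu * mu) (x y : mu) := [\/ I.2 <= I.1, y <= I.1 | I.2 <= x].

(* h is the family built so far: the slots chosen by f must lie inside the path S,
   avoid its right endpoints and be disjoint from all earlier members. *)
Definition eligible a S (h : Idx -> Int) (z : Idx) (f : Fn) :=
  let: (j, (A, w)) := z in
  [/\ A `<=` ss_dom (Z j), unbounded A, alive a S j f A,
      almost A (fun k => fits a S (ss_lo (Z j) f k) (ss_hi (Z j) f k) k) &
      forall z', ltI z' z -> almost A (fun k => sep (h z' k) (ss_lo (Z j) f k) (ss_hi (Z j) f k))].

Variable bot : mu.

(** Emptying the exceptional blocks makes [fits] hold in every block where the interval is nonempty,
    not only in almost all blocks of [A]. *)
Definition trim a S (j f : Fn) (A : set nat) : Int := fun k =>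
  if pselect (A k /\ fits a S (ss_lo (Z j) f k) (ss_hi (Z j) f k) k) is left _
  then (ss_lo (Z j) f k, ss_hi (Z j) f k) else (bot, bot).

Definition family_step a S (z : Idx) (h : Idx -> Int) (I : Int) :=
  (exists2 f, eligible a S h z f & I = trim a S z.1 f z.2.1) \/
  (~ (exists f, eligible a S h z f) /\ I = fun=> (bot, bot)).

Lemma family_exists a S : exists J : Idx -> Int, forall z, family_step a S z J (J z).
Proof.
have [wf _ _] := lexi_wo ltF_wo ltX_wo.
apply: (wf_rec (fun=> (bot, bot)) wf).
  move=> [j [A w]] h h' I hh'.
  have e f : eligible a S h (j, (A, w)) f <-> eligible a S h' (j, (A, w)) f.
    by split=> -[h1 h2 h3 h4 h5]; split=> // z' z'z; [rewrite -hh'|rewrite hh'] => //; exact: h5.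
  move=> [[f ef ->]|[nf ->]]; [left|right]; first by exists f => //; apply/e.
  by split=> // -[f /e ef]; apply: nf; exists f.
move=> z h _; have [[f ef]|nf] := pselect (exists f, eligible a S h z f).
  by exists (trim a S z.1 f z.2.1); left; exists f.
by eexists; right.
Qed.

Local Notation trunc := (trunc lt (fun=> (bot, bot))).

(** Truncation makes the family depend only on the path below [a]. *)
Definition fam a S : Idx -> Int := sval (cid (family_exists a (trunc a S))).

Lemma fam_ext a S S' : agree lt a S S' -> fam a S = fam a S'.
Proof. by move=> SS'; rewrite /fam (trunc_ext (fun=> (bot, bot)) SS'). Qed.

Lemma fits_ext a S S' : agree lt a S S' -> fits a S = fits a S'.
Proof.
move=> SS'; apply: functional_extensionality_dep => x; apply: functional_extensionality_dep => y.
apply: functional_extensionality_dep => k; apply/propext; split=> h c ca.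
  by rewrite -SS' //; exact: h.
by rewrite SS' //; exact: h.
Qed.

Lemma alive_ext a S S' : agree lt a S S' -> alive a S = alive a S'.
Proof.
move=> SS'; apply: functional_extensionality_dep => j; apply: functional_extensionality_dep => f.
apply: functional_extensionality_dep => A; apply/propext; split=> h c ca.
  by rewrite -SS' //; exact: h.
by rewrite SS' //; exact: h.
Qed.

Lemma famP a S z : family_step a S z (fam a S) (fam a S z).
Proof.
have := svalP (cid (family_exists a (trunc a S))) z; rewrite -/(fam a S).
by rewrite /family_step /eligible /trim (fits_ext (@truncE _ _ lt (fun=> (bot, bot)) a S)) (alive_ext (@truncE _ _ lt (fun=> (bot, bot)) a S)).
Qed.

Lemma fam_fits a S z k : (fam a S z k).1 < (fam a S z k).2 ->
  fits a S (fam a S z k).1 (fam a S z k).2 k.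
Proof.
case: (famP a S z) => [[f _ ->]|[_ ->]]; last by rewrite ltxx.
by rewrite /trim; case: pselect => [[]//|_] /=; rewrite ltxx.
Qed.

Lemma fam_disj a S z z' : ltI z' z -> small (iset (fam a S z') `&` iset (fam a S z)).
Proof.
move=> z'z; case: (famP a S z) => [[f ef ->]|[_ ->]]; last first.
  apply: small_sub (small0 m) => x [_ [k _]] /andP[/= h1 h2].
  by have := le_lt_trans h1 h2; rewrite ltxx.
move: z z'z ef => [j [A w]] z'z [_ _ _ _ /(_ _ z'z)[N NP]].
apply: (small_finite_blocks mP (N := N)) => x k [[k1 xk1 h1] [k2 xk2 h2]] xk.
rewrite (blk_uniq xk1 xk) in h1; rewrite (blk_uniq xk2 xk) in h2.
rewrite ltnNge; apply/negP => Nk; move: h2; rewrite /trim; case: pselect => [[Ak _]|_] /andP[/= h2 h3].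
  case/andP: h1 => h0 h1; case: (NP _ Nk Ak) => e.
  - by have := le_lt_trans h0 (lt_le_trans h1 e); rewrite ltxx.
  - by have := le_lt_trans h0 (lt_le_trans h3 e); rewrite ltxx.
  - by have := le_lt_trans h2 (lt_le_trans h1 e); rewrite ltxx.
by have := le_lt_trans h2 h3; rewrite ltxx.
Qed.

Definition evt a S (I : Int) (p : set mu) := (exists z, I = fam a S z) /\ small (p `\` iset I).

Lemma evt_loc a S S' I p : agree lt a S S' -> evt a S I p -> evt a S' I p.
Proof. by move=> /fam_ext SS' [[z ->] h]; split=> //; exists z; rewrite SS'. Qed.

Lemma evt_uniq a S I I' p p' : evt a S I p -> evt a S I' p' -> ~ small (p `&` p') -> I = I'.
Proof.
have [_ _ tot] := lexi_wo ltF_wo ltX_wo.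
move=> [[z ->] sp] [[z' ->] sp'] npp'.
have key : ~ small (iset (fam a S z) `&` iset (fam a S z')).
  apply: contra_not npp' => h; apply: small_sub (smallU mP h (smallU mP sp sp')).
  move=> x [px p'x]; have [i1|n1] := pselect (iset (fam a S z) x); last by right; left.
  by have [i2|n2] := pselect (iset (fam a S z') x); [left|right; right].
case: (tot z z') => [h|-> //|h]; first by case: key; exact: fam_disj.
by case: key; rewrite setIC; exact: fam_disj.
Qed.

Definition legit a S := forall c, lt c a -> exists z, S c = fam c S z.

Definition cut (q : set mu) (j f : Fn) (A : set nat) : set mu :=
  [set x | q x /\ exists2 k, A k & blk m k x /\ slot (ss_lo (Z j) f k) (ss_hi (Z j) f k) x].

Lemma cut_large q j f A : slots_meet m q (Z j) -> A `<=` ss_dom (Z j) -> unbounded A ->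
  ~ small (cut q j f A).
Proof.
move=> qj Aj Au [n h]; have [K KP] := qj n; have [k Kk Ak] := Au K.
apply: (KP k f Kk (Aj _ Ak)); apply: card_le_trans (h k); apply: subset_card_le.
by move=> x [[qx xk] xs]; split=> //; split=> //; exists k.
Qed.

Lemma cut_decides q a S j f A : legit a S -> alive a S j f A ->
  decides lt evt a S (cut q j f A).
Proof.
move=> Sl Sa c ca; split; first exact: Sl.
have [N NP] := Sa _ ca; apply: (small_finite_blocks mP (N := N)) => x k [[_ [k' Ak' [xk' xs]]] nx].
move=> /(blk_uniq xk') <-; rewrite ltnNge; apply/negP => Nk; apply: nx; exists k' => //.
by have [h1 h2] := NP _ Nk Ak'; case/andP: xs => h3 h4; rewrite /slot /= (le_trans h1 h3) (lt_le_trans h4 h2).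
Qed.

Definition killed (j : Fn) (N : nat -> set mu) : set Fn :=
  [set f | ~ almost (ss_dom (Z j)) (fun k => forall r, N k r -> ~ (ss_lo (Z j) f k < r <= ss_hi (Z j) f k))].

(* The slots of distinct f are eventually disjoint, so f is determined by the
   infinitely many points of N that its slots contain. *)
Lemma killed_card j N : slot_system_axioms (Z j) -> (forall k, N k #<= [set: nat]) ->
  killed j N #<= [set: set nat].
Proof.
move=> Zj Nc.
have [cd cdP] : exists cd : nat -> mu -> nat, forall k x y, N k x -> N k y -> cd k x = cd k y -> x = y.
  have h k : exists cd : mu -> nat, forall x y, N k x -> N k y -> cd x = cd y -> x = y.
    have /card_leRP[R [tR iR]] := Nc k.
    have h' x : exists n, N k x -> R x n.
      have [Nx|nN] := pselect (N k x); last by exists 0.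
      by have [n _ xn] := tR _ Nx; exists n.
    have [cd cdP] := choice h'; exists cd => x y Nx Ny e.
    by apply: (iR _ _ (cd x)) => //; [exact: cdP|rewrite e; exact: cdP].
  by have [cd cdP] := choice h; exists cd.
pose code f : set nat := [set n | exists k r, [/\ ss_dom (Z j) k, N k r,
  ss_lo (Z j) f k < r <= ss_hi (Z j) f k & n = pickle (k, cd k r)]].
apply: (card_le_fun (f := code)) => // f f' fk f'k e; apply: contrapT => /(ss_ev Zj)[M MP].
have [k Mk [dk]] := not_almost fk M.
move=> /existsNP[r /not_implyP[Nr /contrapT fr]].
have : code f (pickle (k, cd k r)) by exists k, r.
rewrite e => -[k' [r' [dk' Nr' f'r' /(pcan_inj pickleK)[kk']]]].
rewrite -{}kk' in dk' Nr' f'r' * => /(cdP _ _ _ Nr Nr') rr'; rewrite -{}rr' in f'r'.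
case/andP: fr f'r' => f1 f2 /andP[f3 f4]; case: (MP k Mk dk) => h.
  by have := lt_le_trans f3 (le_trans f2 h); rewrite ltxx.
by have := lt_le_trans f1 (le_trans f4 h); rewrite ltxx.
Qed.

Hypothesis Zmeet : forall q, ~ small q ->
  exists2 j, slot_system_axioms (Z j) & slots_meet m q (Z j).

Definition alive_states a (j : Fn) : set (Om -> Int) :=
  [set trunc a S | S in [set S | legit a S /\ exists f A,
     [/\ A `<=` ss_dom (Z j), unbounded A & alive a S j f A]]].

Definition served a S j A := [/\ A `<=` ss_dom (Z j), unbounded A, legit a S &
  forall w, exists f, eligible a S (fam a S) (j, (A, w)) f].

(** Outside this set, the slots of [f] are eventually not cut by right endpoints of the path, and,
    for each earlier member, eventually not cut by its endpoints. *)
Definition bad_slots a j (S : Om -> Int) : set Fn :=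
  killed j (fun k => [set r | exists2 c, lt c a & r = (S c k).2]) `|`
  \bigcup_(z in below j) killed j (fun k => [set (fam a S z k).1; (fam a S z k).2]).

Lemma bad_slots_card j a S : slot_system_axioms (Z j) -> bad_slots a j S #<= below j.
Proof.
move=> Zj; apply: card_leU; first exact: below_infinite.
  apply: card_le_trans (cont_below j); apply: (killed_card Zj) => k.
  apply: card_le_trans (o1_countable omP a).
  apply: card_le_trans (card_image_le (fun c => (S c k).2) _).
  by apply: subset_card_le => r [c ca ->]; exists c.
apply: (card_le_bigcup (@below_infinite j) (card_lexx _)) => z _.
apply: card_le_trans (cont_below j); apply: (killed_card Zj) => k.
by apply: finite_set_countable; exact: finite_set2.
Qed.

(** The slots of [f] are followed through all levels. At each level some earlier member of the
    family blocks [f], and that member becomes the next entry of the path. *)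
Lemma slot_path j f : slot_system_axioms (Z j) ->
  (forall a S A, ~ served a S j A) ->
  (forall a S, alive_states a j S -> ~ bad_slots a j S f) ->
  exists SA : Om -> Int * set nat, forall a,
    let S := fun c => (SA c).1 in
    [/\ unbounded (SA a).2, exists z, S a = fam a S z &
       forall k, (SA a).2 k -> [/\ ss_dom (Z j) k, (S a k).1 <= ss_lo (Z j) f k &
         ss_hi (Z j) f k <= (S a k).2]].
Proof.
move=> Zj nserved fgood; have [wf tr tot] := o1_wo omP.
pose S_ (h : Om -> Int * set nat) c := (h c).1.
have [||h hP] := @wf_rec Om (Int * set nat) lt (fun=> (bot, bot), set0)
  (fun a h y => [/\ unbounded y.2, exists z, y.1 = fam a (S_ h) z,
     forall c, lt c a -> almost y.2 (h c).2 &
     forall k, y.2 k -> [/\ ss_dom (Z j) k, (y.1 k).1 <= ss_lo (Z j) f k &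
         ss_hi (Z j) f k <= (y.1 k).2]]) wf.
- move=> a h h' y hh' [yu [z yz] yd yk]; split=> //.
    by exists z; rewrite yz (@fam_ext a (S_ h) (S_ h')) // => c ca; rewrite /S_ hh'.
  by move=> c ca; rewrite -hh' //; exact: yd.
- move=> a h IH; pose S := S_ h.
  have [||||||A [Adom Au] Ah] := @countable_chain Om (set nat) lt
      (fun A => A `<=` ss_dom (Z j) /\ unbounded A) almost (ss_dom (Z j)) a (fun c => (h c).2)
      (o1_wo omP) (o1_countable omP a).
  + by move=> A; exists 0.
  + by move=> A B C; exact: almost_sub.
  + move=> g gg gd.
    have [|A Au Ag] := unbounded_pseudo_intersection _ gd; first by move=> n; have [] := gg n.
    exists (A `&` ss_dom (Z j)).
      split; first by move=> k [].
      apply: unbounded_almost => //; apply: almost_sub (Ag 0) _.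
      by exists 0 => k _; have [+ _] := gg 0; apply.
    by move=> n; have [N NP] := Ag n; exists N => k Nk [Ak _]; exact: NP.
  + by split=> //; exact: ss_unb Zj.
  + move=> c ca; have [cu _ _ ck] := IH _ ca; split=> // k /ck[].
    by [].
  + by move=> c c' c'c ca; have [_ _ + _] := IH _ ca; apply.
  have Sl : legit a S by move=> c ca; have [_ [z cz] _ _] := IH _ ca; exists z.
  have Sa : alive a S j f A.
    move=> c ca; apply: almost_sub (Ah _ ca) _; exists 0 => k _ ck.
    by have [_ _ _ /(_ _ ck)[]] := IH _ ca.
  (* Since [A] is not served, some label has no eligible candidate; in particular, [f] is not
     eligible for it. *)
  have [w nw] : exists w, ~ exists f, eligible a S (fam a S) (j, (A, w)) f.
    apply: contrapT => nw; apply: (nserved a S A); split=> // w.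
    by apply: contrapT => h'; apply: nw; exists w.
  have nb : ~ bad_slots a j (trunc a S) f.
    by apply: fgood; exists S => //; split=> //; exists f, A.
  have fitA : almost A (fun k => fits a S (ss_lo (Z j) f k) (ss_hi (Z j) f k) k).
    have : almost (ss_dom (Z j)) (fun k => fits a S (ss_lo (Z j) f k) (ss_hi (Z j) f k) k).
      have [N NP] : almost (ss_dom (Z j)) (fun k => forall r : mu,
          [set r | exists2 c, lt c a & r = (trunc a S c k).2] r ->
          ~ (ss_lo (Z j) f k < r <= ss_hi (Z j) f k)).
        by apply: contrapT => n; apply: nb; left.
      exists N => k Nk dk c ca; have := NP k Nk dk (S c k).2.
      move=> h'; case: (leP (S c k).2 (ss_lo (Z j) f k)) => lo; first by left.
      right; rewrite ltNge; apply/negP => hi; apply: h'; last by rewrite lo hi.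
      by exists c => //; rewrite truncE.
    by apply: almost_sub; exists 0 => k _ /Adom.
  (* Only separation from an earlier member can fail for [f], so its slots meet one such member in
     unboundedly many blocks. *)
  have [z [zb zs]] : exists z, below j z /\
      ~ almost A (fun k => sep (fam a S z k) (ss_lo (Z j) f k) (ss_hi (Z j) f k)).
    apply: contrapT => nz; apply: nw; exists f; split=> // z zl.
    apply: contrapT => ns; apply: nz; exists z; split=> //.
    by case: zl => [zl|[zl _]]; [left|right].
  have [N NP] : almost (ss_dom (Z j)) (fun k => forall r : mu,
      [set (fam a (trunc a S) z k).1; (fam a (trunc a S) z k).2] r ->
      ~ (ss_lo (Z j) f k < r <= ss_hi (Z j) f k)).
    by apply: contrapT => n; apply: nb; right; exists z.
  rewrite (fam_ext (@truncE _ _ lt (fun=> (bot, bot)) a S)) in NP.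
  (* In these blocks the slot meets the member and is not cut by its endpoints, so it lies
     inside. *)
  pose A' := (A `&` [set k | ~ sep (fam a S z k) (ss_lo (Z j) f k) (ss_hi (Z j) f k)]) `&`
    [set k | (N <= k)%N].
  exists (fam a S z, A'); split=> /=.
  + apply: unbounded_almost; first exact: not_almost.
    by exists N.
  + by exists z.
  + by move=> c ca; have [M MP] := Ah c ca; exists M => k Mk [[Ak _] _]; exact: MP.
  + move=> k [[Ak ns] Nk]; have dk := Adom _ Ak; have lohi := ss_lt Zj f dk.
    have ahi : (fam a S z k).1 < ss_hi (Z j) f k.
      by rewrite ltNge; apply/negP => h'; apply: ns; apply: Or32.
    have lob : ss_lo (Z j) f k < (fam a S z k).2.
      by rewrite ltNge; apply/negP => h'; apply: ns; apply: Or33.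
    split=> //.
      rewrite leNgt; apply/negP => h'; apply: (NP k Nk dk (fam a S z k).1); first by left.
      by rewrite h' ltW.
    rewrite leNgt; apply/negP => h'; apply: (NP k Nk dk (fam a S z k).2); first by right.
    by rewrite lob ltW.
exists h => a /=; have [hu hz _ hk] := hP a; split=> //.
Qed.

(** Some block [k] is used at uncountably many levels. All entries at these levels contain the same
    slot in that block, so their right endpoints strictly decrease, against the well-order of
    [mu]. *)
Lemma no_slot_path j f (SA : Om -> Int * set nat) : slot_system_axioms (Z j) ->
  ~ forall a, let S := fun c => (SA c).1 in
    [/\ unbounded (SA a).2, exists z, S a = fam a S z &
       forall k, (SA a).2 k -> [/\ ss_dom (Z j) k, (S a k).1 <= ss_lo (Z j) f k &
         ss_hi (Z j) f k <= (S a k).2]].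
Proof.
move=> Zj SAP; have [wf tr tot] := o1_wo omP.
have [kk kkP] : exists kk : Om -> nat, forall a, (SA a).2 (kk a).
  have h a : exists k, (SA a).2 k by have [/(_ 0)[k _ h] _ _] := SAP a; exists k.
  by have [kk kkP] := choice h; exists kk.
have [k kb] : exists k, ~ ([set a | kk a = k] #<= [set: nat]).
  apply: contrapT => n; apply: (o1_uncountable omP).
  have : [set: Om] `<=` \bigcup_k [set a | kk a = k] by move=> a _; exists (kk a).
  move=> /subset_card_le/card_le_trans; apply; apply: (card_le_bigcup infinite_nat (card_lexx _)).
  by move=> k _; apply: contrapT => h; apply: n; exists k.
have [a0 a0k] : exists a, kk a = k.
  apply: contrapT => n; apply: kb; have -> : [set a | kk a = k] = set0.
    by apply/seteqP; split=> // a ak; apply: n; exists a.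
  exact: card_ge0.
have [b [a ak ab] bmin] := mu_min (bs_sing mP)
  (ex_intro (fun b => exists2 a, kk a = k & b = ((SA a).1 k).2) _ (ex_intro2 _ _ a0 a0k erefl)).
have [c ck ac] : exists2 c, kk c = k & lt a c.
  apply: contrapT => n; apply: kb.
  have : [set c | kk c = k] `<=` [set c | lt c a] `|` [set a].
    move=> c ck; case: (tot c a) => [|->|ac]; [by left|by right|].
    by case: n; exists c.
  move=> /subset_card_le/card_le_trans; apply.
  apply: (card_leU infinite_nat (o1_countable omP a)).
  by apply: finite_set_countable; exact: finite_set1.
have [_ [z cz] /(_ k)] := SAP c; rewrite -ck => /(_ (kkP c))[dk alo hib].
have lohi := ss_lt Zj f dk; rewrite ck in dk alo hib lohi.
have [_ _ /(_ k)] := SAP a; rewrite -{1}ak => /(_ (kkP a))[_ alo' hib'].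
have := @fam_fits c (fun c => (SA c).1) z k; rewrite -cz.
case/(_ (lt_le_trans (le_lt_trans alo lohi) hib) a ac) => h.
  by have := lt_le_trans lohi (le_trans hib' (le_trans h alo)); rewrite ltxx.
by have := bmin _ (ex_intro2 _ _ c ck erefl); rewrite ab leNgt h.
Qed.

(** If both alternatives fail, all bad names together are no more than [below j], so some [f] is
    never bad. Then [slot_path] contradicts [no_slot_path]. *)
Lemma state_dichotomy j : slot_system_axioms (Z j) ->
  (exists a, ~ (alive_states a j #<= below j)) \/ exists a S A, served a S j A.
Proof.
move=> Zj; apply: contrapT => /not_orP[few unserved].
have [f fP] : exists f, forall a S, alive_states a j S -> ~ bad_slots a j S f.
  apply: contrapT => n; apply: (@Fn_below j).
  have : [set: Fn] `<=` \bigcup_(a in [set: Om]) \bigcup_(S in alive_states a j) bad_slots a j S.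
    move=> f _; apply: contrapT => nf; apply: n; exists f => a S aS bf.
    by apply: nf; exists a => //; exists S.
  move=> /subset_card_le/card_le_trans; apply.
  apply: (card_le_bigcup (@below_infinite j) (card_le_trans Om_W (W_below j))) => a _.
  apply: (card_le_bigcup (@below_infinite j)).
    by apply: contrapT => h; apply: few; exists a.
  by move=> S _; exact: bad_slots_card.
have [|SA SAP] := slot_path Zj _ fP.
  by move=> a S A h; apply: unserved; exists a, S, A.
exact: no_slot_path Zj SAP.
Qed.

(** The indices [(false, a)] use Bernstein labels [lo] of paths of length [a]; [(true, a)] reads the
    label from the family index of the entry at [a], on paths of length [sc a]. By
    [state_dichotomy], below each large set one of the two kinds reaches every label. *)
Lemma small_continuum_cover :
  exists2 C : set (set U), nowhere_dense_cover C & C #<= [set: W].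
Proof.
have [wf tr tot] := o1_wo omP.
have [sc scP] : exists sc : Om -> Om, forall a c, lt c (sc a) <-> lt c a \/ c = a.
  have h a : exists b, forall c, lt c b <-> lt c a \/ c = a.
    have [b ab] : exists b, lt a b.
      apply: contrapT => n; apply: (o1_uncountable omP).
      have : [set: Om] `<=` [set c | lt c a] `|` [set a].
        move=> c _; case: (tot c a) => [|->|ac]; [by left|by right|].
        by case: n; exists c.
      move=> /subset_card_le/card_le_trans; apply.
      apply: (card_leU infinite_nat (o1_countable omP a)).
      by apply: finite_set_countable; exact: finite_set1.
    have [b0 ab0 bmin] := wf_min wf (ex_intro (fun b => lt a b) b ab).
    exists b0 => c; split=> [cb|[ca|->//]]; last exact: tr ca ab0.
    by case: (tot c a) => [|->|/(bmin _ cb)//]; [left|right].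
  by have [sc scP] := choice h; exists sc.
have [lo loP] : exists lo : Om -> (Om -> Int) -> option W, forall a j,
    ~ (alive_states a j #<= below j) ->
    forall w, exists2 S, alive_states a j S & lo a S = Some w.
  have h a : exists l : (Om -> Int) -> option W, forall j,
      ~ (alive_states a j #<= below j) -> forall w, exists2 S, alive_states a j S & l S = Some w.
    have [l lP] := label_all W (alive_states a) ltF_wo.
    exists l => j big; apply: lP; apply: contra_not big => /card_le_trans; apply.
    apply: (card_le_fun (f := fun p => (p.1, (set0, p.2)))) => [[j' w] [/= h _] //|].
    by move=> [j1 w1] [j2 w2] _ _ /= [-> ->].
  by have [lo loP] := choice h; exists lo.
(* A large entry has only one index, since the family is almost disjoint, so this label does not
   depend on the choice made by [cid]. *)
pose li a (S : Om -> Int) := if pselect (exists z, S a = fam a S z /\ ~ small (iset (S a))) is left h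
  then Some (sval (cid h)).2.2 else None.
apply: (machine_cover mP omP evt_loc evt_uniq (T := bool * Om)
  (lev := fun t => if t.1 then sc t.2 else t.2)
  (l := fun t S => if t.1 then li t.2 S else lo t.2 (trunc t.2 S))).
- apply: contra_not W_Om => /card_le_trans; apply.
  have -> : [set: bool * Om] = [set: bool] `*` [set: Om] by apply/seteqP; split.
  apply: (card_leX_inf Om_infinite) (card_lexx _).
  apply: card_le_trans (finite_set_countable _) ((infiniteP _).1 Om_infinite).
  exact: finite_finset.
- move=> [[] a] S S' /= SS'.
    have e : S a = S' a by apply: SS'; apply/scP; right.
    have e' : fam a S = fam a S' by apply: fam_ext => c ca; apply: SS'; apply/scP; left.
    by rewrite /li e e'.
  by rewrite (trunc_ext (fun=> (bot, bot)) SS').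
move=> q w ql; have [j Zj qj] := Zmeet ql.
have [[a /loP/(_ w)[_ [S [Sl [f [A [Ad Au Sa]]]] <-] lS]]|[a [S [A [Ad Au Sl sv]]]]] := state_dichotomy Zj.
  exists (false, a), S, (cut q j f A); split=> //=.
  - exact: cut_large.
  - by move=> x [].
  - exact: cut_decides.
have [f0 ef0] := sv w; pose z : Idx := (j, (A, w)).
have [f ef zE] : exists2 f, eligible a S (fam a S) z f & fam a S z = trim a S j f A.
  case: (famP a S z) => [[f ef e]|[nf _]]; first by exists f.
  by case: nf; exists f0.
have [_ _ Sa fitA _] := ef.
pose S' c := if pselect (c = a) is left _ then fam a S z else S c.
have irr : ~ lt a a by exact: wf_irr wf.
have SS' : agree lt a S S'.
  by move=> c ca; rewrite /S'; case: pselect => // ca'; case: irr; rewrite -{1}ca'.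
have S'a : S' a = fam a S z by rewrite /S'; case: pselect.
(* [trim] empties the blocks of [A] that are left out here. *)
pose A' := A `&` [set k | fits a S (ss_lo (Z j) f k) (ss_hi (Z j) f k) k].
have A'u : unbounded A' by exact: unbounded_almost.
have q'z : cut q j f A' `<=` iset (fam a S z).
  move=> x [_ [k [Ak fk] [xk xs]]]; exists k => //; rewrite zE /trim.
  by case: pselect => // -[].
have q'l : ~ small (cut q j f A') by apply: cut_large => // k [/Ad].
exists (true, a), S', (cut q j f A'); split=> //=.
- by move=> x [].
- move=> c /scP[ca|->].
    apply: (evt_loc (S := S)); first by move=> b bc; apply: SS'; exact: tr bc ca.
    rewrite -SS' //; apply: (@cut_decides q a S j f A' Sl _ c ca) => b bb.
    by have [N NP] := Sa _ bb; exists N => k Nk [Ak _]; exact: NP.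
  apply: (evt_loc SS'); rewrite S'a; split; first by exists z.
  by apply: small_sub (small0 m) => x [/q'z].
- have fe := fam_ext SS'.
  rewrite /li; case: pselect => [h|[]]; last first.
    by exists z; rewrite S'a -fe; split=> //; apply: contra_not q'l; exact: small_sub.
  case: cid => -[j' [B w']] /=; rewrite S'a -fe => -[e nz].
  have [_ _ totI] := lexi_wo ltF_wo ltX_wo.
  case: (totI z (j', (B, w'))) => [l|[_ _ -> //]|l].
    by case: nz; have := @fam_disj a S _ _ l; rewrite -e setIid.
  by case: nz; have := @fam_disj a S _ _ l; rewrite -e setIid.
Qed.

End SmallContinuum.

(** * The case mu <= 2^omega *)

Section LargeContinuum.
Variables (d : Order.disp_t) (mu : orderType d) (m : nat -> mu).
Hypothesis mP : block_seq m.
Local Notation U := (uniform_ultrafilters mu).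
Local Notation small := (small m).
Local Notation kap := (kap m).
Local Open Scope order_scope.
Variables (Om : Type) (lt : Om -> Om -> Prop).
Hypothesis omP : omega1_order lt.
Variable W : Type.
Hypothesis W_Om : ~ ([set: W] #<= [set: Om]).
Hypothesis cont_W : ~ ([set: set nat] #<= [set: W]).
Hypothesis mu_cont : [set: mu] #<= [set: set nat].

Local Notation Fn := (nat -> mu).

Variable ltE : Fn -> Fn -> Prop.
Hypothesis ltE_wo : is_wo ltE.

(** In block [k] this is the part of an interval ending at [y k] that starts after the earlier
    endpoints not above [y k]. It is empty if [y k] is itself an earlier endpoint. *)
Definition region (a : Om) (S : Om -> Fn) (y : Fn) : set mu := [set x | exists2 k, blk m k x &
  x < y k /\ forall c, lt c a -> S c k <= x \/ y k < S c k].

(** Different regions may overlap; taking the first [y] in a fixed well-order makes the entry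
    unique. *)
Definition first_region a S (y : Fn) (p : set mu) :=
  small (p `\` region a S y) /\ forall y', ltE y' y -> small (p `&` region a S y').

Lemma region_ext a S S' : agree lt a S S' -> region a S = region a S'.
Proof.
move=> SS'; apply: functional_extensionality_dep => y; apply/seteqP.
split=> x [k xk [xy h]]; exists k => //; split=> // c ca; first by rewrite -SS' //; exact: h.
by rewrite SS' //; exact: h.
Qed.

Lemma first_region_loc a S S' y p : agree lt a S S' -> first_region a S y p -> first_region a S' y p.
Proof. by move=> /region_ext SS' [h h']; rewrite /first_region -SS'. Qed.

Lemma first_region_uniq a S y y' p p' : first_region a S y p -> first_region a S y' p' ->
  ~ small (p `&` p') -> y = y'.
Proof.
move=> [h h'] [g g'] n; have [_ _ tot] := ltE_wo.
case: (tot y y') => [l|//|l]; case: n.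
  apply: small_sub (smallU mP h (g' _ l)) => x [px p'x].
  by have [r|r] := pselect (region a S y x); [right|left].
apply: small_sub (smallU mP g (h' _ l)) => x [px p'x].
by have [r|r] := pselect (region a S y' x); [right|left].
Qed.

Lemma first_region_sub a S y p p' : small (p' `\` p) -> first_region a S y p -> first_region a S y p'.
Proof.
move=> s [h h']; split=> [|y' /h' h'']; first exact: (almost_trans mP s h).
by apply: small_sub (smallU mP s h'') => x [p'x r]; have [px|px] := pselect (p x); [right|left].
Qed.

Lemma decides_sub a S p p' : small (p' `\` p) ->
  decides lt first_region a S p -> decides lt first_region a S p'.
Proof. by move=> s h c ca; apply: first_region_sub s (h c ca). Qed.

(** Sort the points by the next endpoint [r] above them; there are countably many classes. If every
    cut at a point below [r] leaves at most [kap n] points, then each class has at most [kap n.+1]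
    points. *)
Lemma region_block (q : set mu) (R : set mu) k n : R #<= [set: nat] ->
  ~ (q `&` blk m k #<= kap n.+1) -> exists y,
  ~ (q `&` blk m k `&` [set x | x < y /\ forall r, R r -> r <= x \/ y < r] #<= kap n).
Proof.
move=> Rc nq; apply: contrapT => h; apply: nq; set Q := q `&` blk m k.
pose C r := Q `&` [set x | x < r /\ forall r', R r' -> r' <= x \/ r <= r'].
have k_inf i : infinite_set (kap i) by exact: kap_infinite.
have : Q `<=` \bigcup_(r in R `|` [set m k]) C r.
  move=> x Qx; have xk : x < m k by have [] := Qx.2.
  have [r [Rr xr] rmin] := mu_min (bs_sing mP)
    (ex_intro (fun r => (R `|` [set m k]) r /\ x < r) (m k) (conj (or_intror erefl) xk)).
  exists r => //; split=> //; split=> // r' Rr'.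
  by case: (leP r' x) => xr'; [left|right; apply: rmin; split=> //; left].
move=> /subset_card_le/card_le_trans; apply; apply: (card_le_bigcup (k_inf n.+1)).
  apply: card_le_trans (nat_kap mP _); apply: (card_leU infinite_nat Rc).
  by apply: finite_set_countable; exact: finite_set1.
move=> r _; apply: (card_le_initial (A := kap n) (mu_wo (bs_sing mP)) (k_inf _) (kap_lt mP (ltnSn n))).
move=> x [Qx [xr xR]]; apply: contrapT => hx; apply: h; exists x.
apply: contra_not hx; apply: card_le_trans; apply: subset_card_le.
move=> u [[Qu [ur uR]] ux]; split=> //; split=> // r' /uR[|rr']; first by left.
by right; exact: lt_le_trans rr'.
Qed.

Lemma region_large a S q : ~ small q -> exists y, ~ small (q `&` region a S y).
Proof.
move=> ql; pose R k : set mu := [set S c k | c in [set c | lt c a]].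
have Rc k : R k #<= [set: nat].
  exact: card_le_trans (card_image_le _ _) (o1_countable omP a).
pose T k y := q `&` blk m k `&` [set x | x < y /\ forall r, R k r -> r <= x \/ y < r].
have [bot _] := infinite_setN0 (@kap_infinite _ _ _ mP 0).
(* One [y] must serve all [n] at most [k]; a choice for the largest relevant [n] also serves the
   smaller ones. *)
have yP k : exists y, forall n, (n <= k)%N -> ~ (q `&` blk m k #<= kap n.+1) -> ~ (T k y #<= kap n).
  suff h b : exists y, forall n, (n < b)%N -> ~ (q `&` blk m k #<= kap n.+1) -> ~ (T k y #<= kap n).
    by have [y yP] := h k.+1; exists y => n; exact: yP.
  elim: b => [|b [y IH]]; first by exists bot.
  have [small_b|/(region_block (Rc k))[z zP]] := pselect (q `&` blk m k #<= kap b.+1).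
    exists y => n; rewrite ltnS leq_eqVlt => /orP[/eqP -> /(_ small_b)//|]; exact: IH.
  exists z => n nb _ h; apply: zP; apply: card_le_trans h (kap_le mP _); exact: nb.
have [y {}yP] := choice yP.
exists y => -[n h]; have [k nk hk] := large_blk mP n.+1 ql.
apply: (yP k n (ltnW nk) hk); apply: card_le_trans (h k); apply: subset_card_le.
move=> x [[qx xk] [xy xR]]; split=> //; split=> //; exists k => //; split=> // c ca.
by apply: xR; exists c.
Qed.

Lemma first_region_ex a S q : ~ small q ->
  exists y p, [/\ ~ small p, p `<=` q & first_region a S y p].
Proof.
move=> /(region_large a S)[y0 y0P]; have [wf _ _] := ltE_wo.
have [y yl ymin] := wf_min wf (ex_intro (fun y => ~ small (q `&` region a S y)) y0 y0P).
exists y, (q `&` region a S y); split=> //; first by move=> x [].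
split=> [|y' /ymin/contrapT]; first by apply: small_sub (small0 m) => x [[]].
by apply: small_sub => x [[]].
Qed.

Lemma generic_path q : ~ small q -> exists (S : Om -> Fn) (r : Om -> set mu),
  forall a, [/\ ~ small (r a), r a `<=` q, first_region a S (S a) (r a) &
    decides lt first_region a S (r a)].
Proof.
move=> ql; have [wf tr tot] := o1_wo omP.
pose S_ (h : Om -> Fn * set mu) c := (h c).1.
have [||h hP] := @wf_rec Om (Fn * set mu) lt (m, set0)
  (fun a h y => [/\ ~ small y.2, y.2 `<=` q, first_region a (S_ h) y.1 y.2 &
     forall c, lt c a -> small (y.2 `\` (h c).2)]) wf.
- move=> a h h' y hh' [yl yq yf yd]; split=> //.
    by apply: first_region_loc yf => c ca; rewrite /S_ hh'.
  by move=> c ca; rewrite -hh' //; exact: yd.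
- move=> a h IH.
  have [||||||p [pl pq] ph] := @countable_chain Om (set mu) lt (fun p => ~ small p /\ p `<=` q)
    (fun p p' => small (p `\` p')) q a (fun c => (h c).2) (o1_wo omP) (o1_countable omP a).
  + by move=> x; rewrite setDv; exact: small0.
  + exact: (almost_trans mP).
  + move=> f fg fd; have [|p [pl p0 pf]] := pseudo_intersection mP _ fd.
      by move=> n; have [] := fg n.
    by exists p => //; split=> //; apply: subset_trans p0 _; have [] := fg 0.
  + by split.
  + by move=> c ca; have [] := IH c ca.
  + by move=> c c' c'c ca; have [_ _ _] := IH c ca; apply.
  have [y [r [rl rp rf]]] := first_region_ex a (S_ h) pl.
  exists (y, r); split=> //=; first exact: subset_trans rp pq.
  by move=> c ca; apply: small_sub (ph c ca) => x [/rp]; split.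
exists (S_ h), (fun a => (h a).2) => a; have [hl hq hf hd] := hP a; split=> //.
move=> c ca; have [_ _ hfc _] := hP c.
exact: first_region_sub (hd _ ca) hfc.
Qed.

(** Uncountably many levels share one bound [n]. In a block where [q] exceeds [kap n], any two of
    their regions share a point, so the endpoints in this block strictly decrease with the level. *)
Lemma no_decided_path q S : ~ small q -> (forall a, small (q `\` region a S (S a))) -> False.
Proof.
move=> ql qS; have [wf tr tot] := o1_wo omP.
have [nn nnP] : exists nn : Om -> nat, forall a k, (q `\` region a S (S a)) `&` blk m k #<= kap (nn a).
  by have [nn nnP] := choice qS; exists nn.
have [n nb] : exists n, ~ ([set a | nn a = n] #<= [set: nat]).
  apply: contrapT => h; apply: (o1_uncountable omP).
  have : [set: Om] `<=` \bigcup_n [set a | nn a = n] by move=> a _; exists (nn a).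
  move=> /subset_card_le/card_le_trans; apply; apply: (card_le_bigcup infinite_nat (card_lexx _)).
  by move=> k _; apply: contrapT => h'; apply: h; exists k.
have [k _ kb] := large_blk mP n ql.
have dec a c : nn a = n -> nn c = n -> lt a c -> S c k < S a k.
  move=> an cn ac.
  have [x [[qx xk] [xa xc]]] : exists x, (q `&` blk m k) x /\ region a S (S a) x /\ region c S (S c) x.
    apply: contrapT => nx; apply: kb.
    have : q `&` blk m k `<=` ((q `\` region a S (S a)) `&` blk m k) `|` ((q `\` region c S (S c)) `&` blk m k).
      move=> x [qx xk]; have [xa|xa] := pselect (region a S (S a) x); last by left.
      by right; split=> //; split=> // xc; apply: nx; exists x.
    move=> /subset_card_le/card_le_trans; apply; apply: card_leU; first exact: kap_infinite.
      by rewrite -an; exact: nnP.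
    by rewrite -cn; exact: nnP.
  case: xa xc => k1 xk1 [xa _] [k2 xk2 [xc /(_ _ ac)]].
  rewrite (blk_uniq xk1 xk) in xa; rewrite (blk_uniq xk2 xk) in xc *.
  by case=> // h; have := lt_le_trans xa h; rewrite ltxx.
have [a0 a0n] : exists a, nn a = n.
  apply: contrapT => h; apply: nb; have -> : [set a | nn a = n] = set0.
    by apply/seteqP; split=> // a an; apply: h; exists a.
  exact: card_ge0.
have [b [a an ab] bmin] := mu_min (bs_sing mP)
  (ex_intro (fun b => exists2 a, nn a = n & b = S a k) _ (ex_intro2 _ _ a0 a0n erefl)).
have [c cn ac] : exists2 c, nn c = n & lt a c.
  apply: contrapT => h; apply: nb.
  have : [set c | nn c = n] `<=` [set c | lt c a] `|` [set a].
    move=> c cn; case: (tot c a) => [|->|ac]; [by left|by right|].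
    by case: h; exists c.
  move=> /subset_card_le/card_le_trans; apply.
  apply: (card_leU infinite_nat (o1_countable omP a)).
  by apply: finite_set_countable; exact: finite_set1.
have := bmin _ (ex_intro2 _ _ c cn erefl); rewrite ab leNgt.
by rewrite (dec _ _ an cn ac).
Qed.

Lemma Om_bound (e : nat -> Om) : exists a, forall n, lt (e n) a.
Proof.
have [wf tr tot] := o1_wo omP.
apply: contrapT => h; apply: (o1_uncountable omP).
have : [set: Om] `<=` \bigcup_n ([set c | lt c (e n)] `|` [set e n]).
  move=> c _; apply: contrapT => nc; apply: h; exists c => n; case: (tot (e n) c) => [//|ec|ce].
    by case: nc; exists n => //; right.
  by case: nc; exists n => //; left.
move=> /subset_card_le/card_le_trans; apply; apply: (card_le_bigcup infinite_nat (card_lexx _)).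
move=> n _; apply: (card_leU infinite_nat (o1_countable omP _)).
by apply: finite_set_countable; exact: finite_set1.
Qed.

Local Notation Dec := (decides lt first_region).

Lemma dec_uniq a S S' p p' : Dec a S p -> Dec a S' p' -> ~ small (p `&` p') -> agree lt a S S'.
Proof. exact: (decides_uniq omP first_region_loc first_region_uniq). Qed.

(** By [no_decided_path], a generic path [S] below [q] has a level [a] where a large part of [q]
    lies outside its region. A generic path below that part must leave [S] at or before [a]. *)
Lemma decides_split q : ~ small q -> exists a S0 S1 q0 q1,
  [/\ ~ small q0 /\ ~ small q1, q0 `<=` q, q1 `<=` q, Dec a S0 q0 /\ Dec a S1 q1 & ~ agree lt a S0 S1].
Proof.
move=> ql; have [S [r Sr]] := generic_path ql; apply: contrapT => nsplit.
apply: (no_decided_path ql (S := S)) => a; apply: contrapT => al.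
have [S' [r' Sr']] := generic_path al.
have [b ab] := Om_bound (fun=> a).
have [rl rq _ rd] := Sr b; have [rl' rq' _ rd'] := Sr' b.
have : agree lt b S S'.
  apply: contrapT => n; apply: nsplit; exists b, S, S', (r b), (r' b); split=> //.
  by apply: subset_trans rq' _ => x [].
move=> SS'; have [wf tr tot] := o1_wo omP.
have [h _] := rd' a (ab 0); apply: rl'; apply: small_sub h => x r'x; split=> //.
rewrite -(SS' a (ab 0)) -(@region_ext a S S'); first by have [] := rq' _ r'x.
by move=> c ca; apply: SS'; exact: tr ca (ab 0).
Qed.

(** The latest bit comes first, so that extending a node is a [cons]. *)
Fixpoint rprefix (b : nat -> bool) n : seq bool := if n is n'.+1 then b n' :: rprefix b n' else [::].

Definition cantor_tree (a : Om) (av : nat -> Om) (T : nat -> seq bool -> Om -> Fn) :=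
  [/\ forall n, lt (av n) a, forall c, lt c a -> exists n, lt c (av n) &
      forall n s b, ~ agree lt (av n.+1) (T n.+1 (b :: s)) (T n.+1 (~~ b :: s))].

(** Fusion: split every node, bound the countably many splitting levels, decide paths up to that
    bound, and repeat omega times. A pseudo-intersection along a branch decides the union of its
    paths. *)
Lemma cantor_tree_ex q : ~ small q -> exists a av T, cantor_tree a av T /\
  forall b, exists S p, [/\ ~ small p, p `<=` q, Dec a S p &
    forall n, agree lt (av n) S (T n (rprefix b n))].
Proof.
move=> ql; have [wf tr tot] := o1_wo omP.
(* A stage consists of a level and, for each finite sequence, a set with the path that it decides;
   the length of the sequence is not tied to the stage. *)
pose X := (Om * (seq bool -> set mu * (Om -> Fn)))%type.
pose inv (x : X) := forall s, [/\ ~ small (x.2 s).1, (x.2 s).1 `<=` q & Dec x.1 (x.2 s).2 (x.2 s).1].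
pose nextP (x y : X) := inv y /\ [/\ lt x.1 y.1, forall s b, (y.2 (b :: s)).1 `<=` (x.2 s).1 &
  forall s b, ~ agree lt y.1 (y.2 (b :: s)).2 (y.2 (~~ b :: s)).2].
have [x0 x0i] : exists x, inv x.
  have /infinite_setN0[a _] : infinite_set [set: Om].
    by move=> /finite_set_countable; exact: o1_uncountable omP.
  have [S [r Sr]] := generic_path ql; exists (a, fun=> (r a, S)) => s /=.
  by have [] := Sr a.
have step x : exists y, inv x -> nextP x y.
  have [xi|nx] := pselect (inv x); last by exists x.
  pose Sp (s : seq bool) (t : Om * ((Om -> Fn) * (Om -> Fn)) * (set mu * set mu)) :=
    let: (a, (S0, S1), (q0, q1)) := t in
    [/\ ~ small q0 /\ ~ small q1, q0 `<=` (x.2 s).1, q1 `<=` (x.2 s).1,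
      Dec a S0 q0 /\ Dec a S1 q1 & ~ agree lt a S0 S1].
  have [t tP] : exists t, forall s, Sp s (t s).
    have h s : exists t, Sp s t.
      have [sl _ _] := xi s; have [a [S0 [S1 [q0 [q1 h]]]]] := decides_split sl.
      by exists (a, (S0, S1), (q0, q1)).
    by have [t tP] := choice h; exists t.
  (* [a1] bounds the splitting levels of all nodes; the next level [a] lies above both [a1] and the
     current one. *)
  have [a1 a1P] := Om_bound (fun n => if unpickle n is Some s then (t s).1.1 else x.1).
  have [a aP] := Om_bound (fun n => if n is 0 then x.1 else a1).
  have ta s : lt (t s).1.1 a.
    by have := a1P (pickle s); rewrite pickleK => h; exact: tr h (aP 1).
  pose qq s (b : bool) := if b then (t s).2.1 else (t s).2.2.
  have qql s b : ~ small (qq s b).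
    by rewrite /qq; move: (tP s); case: (t s) => -[a' [S0 S1]] [q0 q1] [[]]; case: b.
  have [e eP] : exists e : seq bool * bool -> set mu * (Om -> Fn), forall p,
      [/\ ~ small (e p).1, (e p).1 `<=` qq p.1 p.2 & Dec a (e p).2 (e p).1].
    have h (p : seq bool * bool) : exists y : set mu * (Om -> Fn),
        [/\ ~ small y.1, y.1 `<=` qq p.1 p.2 & Dec a y.2 y.1].
      have [S [r Sr]] := generic_path (@qql p.1 p.2); exists (r a, S).
      by have [] := Sr a.
    by have [e eP] := choice h; exists e.
  have qqs s b : qq s b `<=` (x.2 s).1.
    by rewrite /qq; move: (tP s); case: (t s) => -[a' [S0 S1]] [q0 q1] [_ ? ? _ _]; case: b.
  exists (a, fun s => if s is b :: s' then e (s', b) else e ([::], true)) => _; split.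
    move=> [|b s] /=.
      have [el eq ed] := eP ([::], true); split=> //.
      apply: subset_trans eq _; apply: subset_trans (@qqs [::] true) _.
      by have [] := xi [::].
    have [el eq ed] := eP (s, b); split=> //.
    apply: subset_trans eq _; apply: subset_trans (@qqs s b) _.
    by have [] := xi s.
  split=> /=; first exact: (aP 0).
    by move=> s b; have [_ eq _] := eP (s, b); exact: subset_trans eq (@qqs s b).
  move=> s; suff ns : ~ agree lt a (e (s, true)).2 (e (s, false)).2.
    by case=> //= h; apply: ns => c ca; rewrite h.
  move=> h; move: (tP s) (ta s) (eP (s, true)) (eP (s, false)); rewrite /qq /=.
  case: (t s) => -[a' [S0 S1]] [q0 q1] [_ _ _ [d0 d1] ns] /= a'a [l0 s0 e0] [l1 s1 e1].
  apply: ns => c ca'.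
  have lim i (q' := if i then q0 else q1) (S' := if i then S0 else S1) :
      ~ small (e (s, i)).1 -> (e (s, i)).1 `<=` q' -> Dec a (e (s, i)).2 (e (s, i)).1 ->
      Dec a' S' q' -> agree lt a' S' (e (s, i)).2.
    move=> il iq id' dS.
    apply: (dec_uniq (p := (e (s, i)).1) (p' := (e (s, i)).1)); last by rewrite setIid.
      by apply: decides_sub dS; apply: small_sub (small0 m) => z [/iq].
    by move=> b ba'; apply: id'; exact: tr ba' a'a.
  rewrite (lim true l0 s0 e0 d0 c ca') (lim false l1 s1 e1 d1 c ca').
  by apply: h; exact: tr ca' a'a.
have [nx nxP] := choice step.
pose x n := iter n nx x0.
have xi n : inv (x n) by elim: n => //= n IH; have [] := nxP _ IH.
have xS n : [/\ lt (x n).1 (x n.+1).1, forall s b, ((x n.+1).2 (b :: s)).1 `<=` ((x n).2 s).1 &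
  forall s b, ~ agree lt (x n.+1).1 ((x n.+1).2 (b :: s)).2 ((x n.+1).2 (~~ b :: s)).2].
  by have [] := nxP _ (xi n).
have xle i n : (i < n)%N -> lt (x i).1 (x n).1.
  elim: n => // n IH; rewrite ltnS leq_eqVlt => /orP[/eqP ->|/IH h]; first by have [] := xS n.
  by have [h' _ _] := xS n; exact: tr h h'.
have [a0 a0P] := Om_bound (fun n => (x n).1).
have [a aP amin] := wf_min wf (ex_intro (fun a => forall n, lt (x n).1 a) a0 a0P).
have acof c : lt c a -> exists n, lt c (x n).1.
  move=> /amin/existsNP[n cn]; exists n.+1; case: (tot (x n).1 c) => [//|<-|h].
    by have [] := xS n.
  by have [h' _ _] := xS n; exact: tr h h'.
exists a, (fun n => (x n).1), (fun n s => ((x n).2 s).2); split.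
  by split=> // n s b; have [_ _ h] := xS n; exact: h.
move=> b; pose Q n := ((x n).2 (rprefix b n)).1.
have Qd i n : (i <= n)%N -> Q n `<=` Q i.
  elim: n => [|n IH]; first by rewrite leqn0 => /eqP ->.
  rewrite leq_eqVlt => /orP[/eqP -> //|]; rewrite ltnS => /IH; apply: subset_trans.
  by have [_ h _] := xS n; exact: h.
have Ql n : ~ small (Q n) by have [] := xi n (rprefix b n).
have [|p [pl p0 pQ]] := pseudo_intersection mP Ql.
  by move=> i n /Qd s; apply: small_sub (small0 m) => z [/s].
pose Sn n := ((x n).2 (rprefix b n)).2.
have Snd n : Dec (x n).1 (Sn n) p.
  by apply: decides_sub (pQ n) _; have [] := xi n (rprefix b n).
have SnE i n c : lt c (x i).1 -> lt c (x n).1 -> Sn i c = Sn n c.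
  wlog : i n / (i <= n)%N.
    by move=> wl ci cn; case: (leqP i n) => [/wl|/ltnW/wl] h; [exact: h|apply/esym; exact: h].
  move=> le ci cn; apply: (dec_uniq (p := p) (p' := p) (Snd i)) ci; last by rewrite setIid.
  move: le; rewrite leq_eqVlt => /orP[/eqP ->|/xle l]; first exact: Snd.
  by move=> c' c'i; apply: Snd; exact: tr c'i l.
pose S c := if pselect (exists n, lt c (x n).1) is left h then Sn (sval (cid h)) c else m.
have SE n : agree lt (x n).1 S (Sn n).
  move=> c cn; rewrite /S; case: pselect => [h|[]]; last by exists n.
  by case: cid => i ci /=; exact: SnE.
exists S, p; split=> //.
- by apply: subset_trans p0 _; have [] := xi 0 [::].
- move=> c /acof[n cn]; rewrite (SE n c cn).
  apply: first_region_loc (Snd n c cn) => c' c'c; rewrite (SE n) //; exact: tr c'c cn.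
Qed.

Lemma rprefix_neq (b b' : nat -> bool) : b <> b' ->
  exists n, rprefix b n = rprefix b' n /\ b' n = ~~ b n.
Proof.
move=> bb'; have ex : exists n, b n != b' n.
  apply: contrapT => h; apply: bb'; apply: functional_extensionality_dep => n.
  by apply/eqP; apply: contrapT => /negP hn; apply: h; exists n.
case: (ex_minnP ex) => n bn nmin; exists n; split; last by case: (b n) (b' n) bn => -[].
have : forall i, (i <= n)%N -> rprefix b i = rprefix b' i; last exact.
elim=> //= i IH lin; rewrite IH 1?ltnW //; congr (_ :: _).
by apply/eqP; apply: contraLR lin => /nmin; rewrite -leqNgt.
Qed.

(** Trees are coded by elements of [set C], put in an initial well-order. Different branches yield
    different paths, so each tree has as many paths as there are codes, and [label_all] gives every
    label to every tree. *)
Lemma cantor_labels a : exists l : (Om -> Fn) -> option W, forall av T, cantor_tree a av T ->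
  (forall b, exists S, forall n, agree lt (av n) S (T n (rprefix b n))) ->
  forall w, exists b S, (forall n, agree lt (av n) S (T n (rprefix b n))) /\
    l (trunc lt m a S) = Some w.
Proof.
have [[c0 c0a]|ne] := pselect (exists c, lt c a); last first.
  exists (fun=> None) => av T [avl _ _]; case: ne; exists (av 0); exact: avl.
have [e [ea eS]] := countable_enum (ex_intro (fun c => lt c a) c0 c0a) (o1_countable omP a).
have [i [_ iI]] := card_le_funT mu_cont.
(* [inl (n, k)] says that the level [e k] lies below [av n]; [inr] records the elements [r] of the
   set of naturals coding coordinate [l] of the entry of [T n s] at [e k]. *)
pose C : countType := ((nat * nat) + (nat * seq bool * nat * nat * nat))%type.
have [ltJ [ltJ_wo ltJ_init]] := wo_initial (set C).
pose V (X : set C) : set (Om -> Fn) := [set trunc lt m a S | S in [set S | exists b, forall n k,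
  X (inl (n, k)) -> forall l, i (S (e k) l) = [set r | X (inr (n, rprefix b n, k, l, r))]]].
have [l lP] := label_all W V ltJ_wo.
exists l => av T [avl avc nag] branch w.
pose X : set C := [set c | match c with
  | inl (n, k) => lt (e k) (av n)
  | inr (n, s, k, l, r) => i (T n s (e k) l) r end].
have VX b S : (forall n, agree lt (av n) S (T n (rprefix b n))) <-> (forall n k,
  X (inl (n, k)) -> forall l, i (S (e k) l) = [set r | X (inr (n, rprefix b n, k, l, r))]).
  split=> [h n k kn l'|h n c cn]; first by rewrite (h n (e k) kn).
  have [wf tr tot] := o1_wo omP; have [k kc] := eS c (tr _ _ _ cn (avl n)).
  rewrite -kc in cn *; apply: functional_extensionality_dep => l'; apply: iI.
  exact: h.
have Wi : infinite_set [set: W].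
  have Oi : infinite_set [set: Om] by move=> /finite_set_countable; exact: o1_uncountable omP.
  exact: card_le_infinite (card_leNgt W_Om) Oi.
have big : ~ (V X #<= [set j' | ltJ j' X \/ j' = X] `*` [set: W]).
  have JW : ~ ([set: set C] #<= [set: W]).
    apply: contra_not cont_W; apply: card_le_trans.
    apply: (card_le_fun (f := fun A : set nat => [set (inl (n, 0) : C) | n in A])) => // A A' _ _ AA'.
    have sub (B B' : set nat) : [set (inl (n, 0) : C) | n in B] = [set (inl (n, 0) : C) | n in B'] -> B `<=` B'.
      move=> BB' n Bn; have : [set (inl (n, 0) : C) | n in B] (inl (n, 0)) by exists n.
      by rewrite BB' => -[n' B'n' [<-]].
    by apply/seteqP; split; apply: sub.
  apply: contra_not (initial_prod ltJ_init Wi JW (j := X)); apply: card_le_trans.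
  have [Sb SbP] := choice branch.
  (* The branch attached to [A] follows its characteristic function. *)
  apply: (card_le_fun (f := fun A : set C => trunc lt m a
    (Sb (fun n => if unpickle n is Some c then `[< A c >] else false)))).
    by move=> A _; eexists; last reflexivity; eexists; apply/VX; exact: SbP.
  move=> A A' _ _ AA'; set b := fun n => _ in AA'; pose b' n := if unpickle n is Some c then `[< A' c >] else false.
  have bb' : b = b'.
    apply: contrapT => /rprefix_neq[n [rn bn]]; apply: (nag n (rprefix b n) (b n)) => c cn.
    have ca : lt c a by have [wf tr tot] := o1_wo omP; exact: tr cn (avl _).
    have e1 := SbP b n.+1 c cn; have e2 := SbP b' n.+1 c cn.
    rewrite /= -{}rn {}bn in e2; rewrite -{}e1 -{}e2 -(truncE (lt := lt) m (Sb b) ca).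
    by rewrite -(truncE (lt := lt) m (Sb b') ca) AA'.
  apply/seteqP; split=> c; have := congr1 (fun u : nat -> bool => u (pickle c)) bb';
    by rewrite /b /b' pickleK => h /asboolP h'; apply/asboolP; rewrite ?h // -h.
have [_ [S [b bS] <-] lS] := lP X big w.
by exists b, S; split=> //; apply/VX.
Qed.

Lemma large_continuum_cover :
  exists2 C : set (set U), nowhere_dense_cover C & C #<= [set: W].
Proof.
have [l lP] := choice cantor_labels.
apply: (machine_cover mP omP first_region_loc first_region_uniq (T := Om) (lev := id)
  (l := fun a S => l a (trunc lt m a S))) => //.
  by move=> a S S' SS'; rewrite (trunc_ext m SS').
move=> q w ql; have [a [av [T [ct branch]]]] := cantor_tree_ex ql.
have [|b [S [bS lS]]] := lP a av T ct _ w.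
  by move=> b; have [S [p [_ _ _ h]]] := branch b; exists S.
(* The labelled path [S] and the decided path [S'] follow the same branch, so they agree below
   [a]. *)
have [S' [p [pl pq pd h]]] := branch b.
exists a, S, p; split=> // c ca; have [wf tr tot] := o1_wo omP.
have SS' : agree lt a S' S.
  move=> c' c'a; have [_ /(_ _ c'a)[n c'n] _] := ct.
  by rewrite (h n c' c'n) (bS n c' c'n).
rewrite -(SS' c ca); apply: first_region_loc (pd c ca) => c' c'c.
by apply: SS'; exact: tr c'c ca.
Qed.

End LargeContinuum.

(** * Computation of the Baire number *)

Local Open Scope order_scope.

Lemma is_succ_card_seg (d : Order.disp_t) (mu : orderType d) T (A : set T) (w : mu) :
  is_singular_cardinal mu -> infinite_set A -> ~ (seg w #<= A) ->
  (forall x, x < w -> seg x #<= A) -> is_succ_card A (seg w).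
Proof.
move=> sing Ai wA xA; split; first by split; [exact: card_leNgt|].
move=> V C [leAC nCA]; apply: (card_le_initial (mu_wo sing) (card_le_infinite leAC Ai) nCA) => x xw.
by apply: card_le_trans (xA x xw); apply: subset_card_le => y [].
Qed.

Theorem corollary2p15 (d : Order.disp_t) (mu : orderType d)
  (mu_singular : is_singular_cardinal mu)
  (mu_cofinality : is_cofinality mu [set: nat]%classic) :
  exists (W : Type) (omega2 : set W),
    is_aleph 2 omega2 /\ is_baire_number (uniform_ultrafilters mu) omega2.
Proof.
have [m [m0 mS m_lt m_ex]] := block_bounds mu_singular mu_cofinality.
have mP : block_seq m by split.
(* The segments of the least [w1] and [w2] that exceed omega and [seg w1] in size represent omega1
   and omega2. *)
have [w1 w1P w1min] := mu_min mu_singular (ex_intro (fun w => ~ (seg w #<= [set: nat])) _ m0).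
have w1lt x : x < w1 -> seg x #<= [set: nat].
  by move=> xw; apply: contrapT => /w1min; rewrite leNgt xw.
have w1_inf : infinite_set (seg w1) by move=> /finite_set_countable; exact: w1P.
have [w2' w2'P] := seg_above mu_singular mu_cofinality w1_inf (@seg_lt _ _ mu_singular w1).
have [w2 w2P w2min] := mu_min mu_singular (ex_intro (fun w => ~ (seg w #<= seg w1)) _ w2'P).
have w2lt x : x < w2 -> seg x #<= seg w1.
  by move=> xw; apply: contrapT => /w2min; rewrite leNgt xw.
have succ1 := is_succ_card_seg mu_singular infinite_nat w1P w1lt.
have succ2 := is_succ_card_seg mu_singular w1_inf w2P w2lt.
exists mu, (seg w2); split.
  by exists mu, (seg w1); split=> //; exists nat, setT; split=> //; exact: card_eqxx.
pose Om : Type := seg w1; pose W : Type := seg w2.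
have /card_eqPle[Om1 Om2] : [set: Om] #= seg w1 by exact: card_setT.
have /card_eqPle[W1 W2] : [set: W] #= seg w2 by exact: card_setT.
pose lt (x y : Om) := val x < val y.
have [wf tr tot] := mu_wo mu_singular.
have omP : omega1_order lt.
  split.
  - split.
    + move=> x; move: {2}(val x) (erefl (val x)) => y.
      elim/(well_founded_ind wf): y x => y IH x xy; constructor => z zx.
      by apply: (IH (val z)) => //; rewrite -xy.
    + by move=> x y z; exact: tr.
    + by move=> x y; case: (tot (val x) (val y)) => [h|/val_inj h|h]; [apply: Or31|apply: Or32|apply: Or33].
  - move=> a; apply: card_le_trans (w1lt (val a) (set_valP a)).
    by apply: (card_le_fun (f := val)) => // x y _ _; exact: val_inj.
  - by move=> h; apply: w1P; apply: card_le_trans h.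
have W_Om : ~ ([set: W] #<= [set: Om]).
  by move=> h; apply: w2P; apply: card_le_trans W2 _; apply: card_le_trans h Om1.
(* Every cover has more than omega1 members, hence at least omega2 by the successor property. *)
have lower (C : set (set (uniform_ultrafilters mu))) : nowhere_dense_cover C -> seg w2 #<= C.
  move=> Ccov; have CO := @nowhere_dense_cover_gt _ _ _ mP _ _ omP _ Ccov; case: succ2 => _; apply; split.
    by apply: card_leNgt; apply: contra_not CO => h; apply: card_le_trans h Om2.
  by apply: contra_not CO => h; apply: card_le_trans h Om2.
suff [C Ccov CW] : exists2 C : set (set (uniform_ultrafilters mu)), nowhere_dense_cover C & C #<= [set: W].
  split; last exact: lower.
  by exists C => //; apply/card_eqPle; split; [exact: card_le_trans CW W1|exact: lower].
have muW : ~ ([set: mu] #<= [set: W]).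
  by move=> h; apply: (@seg_lt _ _ mu_singular w2); exact: card_le_trans h W1.
(* Since [mu] exceeds omega2, the continuum exceeds omega2 in the first case; in the second,
   mu^omega exceeds both omega2 and the continuum. *)
have [mu_cont|mu_cont] := pselect ([set: mu] #<= [set: set nat]).
  have [ltE ltE_wo] := wo_exists (nat -> mu).
  apply: (large_continuum_cover mP omP W_Om _ mu_cont ltE_wo).
  by apply: contra_not muW; exact: card_le_trans.
have muF : [set: mu] #<= [set: nat -> mu].
  by apply: (card_le_fun (f := fun x _ => x)) => // x y _ _ /(congr1 (fun u : nat -> mu => u 0)).
have [Z ZP] := slot_systems_exist mP.
have [ltF [ltF_wo ltF_init]] := wo_initial (nat -> mu).
have [ltX ltX_wo] := wo_exists (set nat * W).
apply: (small_continuum_cover mP omP W_Om _ _ ltF_wo ltF_init ltX_wo (m 0) ZP).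
  by apply: contra_not muW; exact: card_le_trans.
by apply: contra_not mu_cont; exact: card_le_trans.
Qed.
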